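(* Let $\mathfrak{A}$ be a unital $C^*$-algebra. For any spreadable state $\varphi$ on $\ast_{\mathbb{N}}\mathfrak{A}$ one has $$\mathcal{H}_\varphi^{\tau}=\mathcal{H}_\varphi^{\mathbb{J}_{\mathbb{N}}}=\overline{\mathcal{T}_\varphi\xi_\varphi}.$$ If $\varphi$ is also exchangeable, then $$\mathcal{H}_\varphi^{\tau}=\mathcal{H}_\varphi^{\mathbb{J}_{\mathbb{N}}}=\mathcal{H}_\varphi^{\mathbb{P}_{\mathbb{N}}}=\overline{\mathcal{T}_\varphi\xi_\varphi}.$$
   Context: $\mathbb{N}=\{0,1,2,\dots\}$. $\ast_{\mathbb{N}}\mathfrak{A}$ is the unital free product $C^*$-algebra (units amalgamated) of copies of $\mathfrak{A}$ indexed by $\mathbb{N}$, with canonical unital embeddings $i_j$. For an injective map $f:\mathbb{N}\to\mathbb{N}$, $\alpha_f$ is the unital $*$-endomorphism with $\alpha_f(i_j(a))=i_{f(j)}(a)$; $\tau$ is the shift, $\tau(i_j(a))=i_{j+1}(a)$. $\mathbb{P}_{\mathbb{N}}$ is the group of bijections of $\mathbb{N}$ moving only finitely many points; $\mathbb{J}_{\mathbb{N}}$ is the semigroup of strictly increasing maps $h:\mathbb{N}\to\mathbb{N}$ with $|\mathbb{N}\setminus h(\mathbb{N})|<\infty$ (it contains $j\mapsto j+1$). A state $\varphi$ is spreadable if $\varphi\circ\alpha_h=\varphi$ for all $h\in\mathbb{J}_{\mathbb{N}}$, and exchangeable if $\varphi\circ\alpha_\sigma=\varphi$ for all $\sigma\in\mathbb{P}_{\mathbb{N}}$.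 $(\pi_\varphi,\mathcal{H}_\varphi,\xi_\varphi)$ is the GNS triple of $\varphi$. $V_\tau$, $V_h$ ($h\in\mathbb{J}_{\mathbb{N}}$) and $U_\sigma$ ($\sigma\in\mathbb{P}_{\mathbb{N}}$, $\varphi$ exchangeable) are the isometries (unitaries for $U_\sigma$) of $\mathcal{H}_\varphi$ given on $\pi_\varphi(x)\xi_\varphi$ by $\pi_\varphi(\tau(x))\xi_\varphi$, $\pi_\varphi(\alpha_h(x))\xi_\varphi$, $\pi_\varphi(\alpha_\sigma(x))\xi_\varphi$ respectively. $\mathcal{H}_\varphi^\tau$, $\mathcal{H}_\varphi^{\mathbb{J}_{\mathbb{N}}}$, $\mathcal{H}_\varphi^{\mathbb{P}_{\mathbb{N}}}$ are the closed subspaces of vectors fixed by $V_\tau$, by all $V_h$, and by all $U_\sigma$, respectively. $\mathcal{T}_\varphi:=\bigcap_{n\in\mathbb{N}}\{\pi_\varphi(i_k(\mathfrak{A})):k\ge n\}''$ is the tail algebra. *)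

(* Defs.v *)
From HB Require Import structures.
From mathcomp Require Import all_boot all_order all_algebra.
From mathcomp Require Import complex.
From mathcomp Require Import all_classical reals topology normedtype.

Set Implicit Arguments.
Unset Strict Implicit.
Unset Printing Implicit Defensive.

Import Order.TTheory GRing.Theory Num.Theory.
Import numFieldNormedType.Exports.

Local Open Scope classical_set_scope.
Local Open Scope complex_scope.
Local Open Scope ring_scope.

(* Unital C*-algebras over R[i], for R the real numbers.
   - The algebra structure is the library's [algType], which entails 1 != 0:
     the zero algebra, which has no state, is excluded.
   - The norm is a field of the mixin because Hierarchy Builder rejects a join
     of [NormedModule] and [Algebra] below [NumDomain]; completeness is
     therefore stated with Cauchy sequences. *)
HB.mixin Record isCstarAlg (R : realType) (A : Type)
    of GRing.Algebra R[i] A := {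
  star : A -> A;
  cnorm : A -> R;
  starK : involutive star;
  starD : {morph star : x y / x + y};
  starZ : forall (a : R[i]) (x : A), star (a *: x) = Num.conj a *: star x;
  starM : forall x y : A, star (x * y) = star y * star x;
  cnorm0_eq0 : forall x : A, cnorm x = 0 -> x = 0;
  ler_cnormD : forall x y : A, cnorm (x + y) <= cnorm x + cnorm y;
  cnormZ : forall (a : R[i]) (x : A),
    (cnorm (a *: x))%:C = `|a| * (cnorm x)%:C;
  ler_cnormM : forall x y : A, cnorm (x * y) <= cnorm x * cnorm y;
  cnorm_starM : forall x : A, cnorm (star x * x) = cnorm x ^+ 2;
  cnorm_complete : forall u : nat -> A,
    (forall e : R, 0 < e -> exists N : nat, forall m n : nat,
      (N <= m)%N -> (N <= n)%N -> cnorm (u m - u n) < e) ->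
    exists l : A, forall e : R, 0 < e -> exists N : nat, forall n : nat,
      (N <= n)%N -> cnorm (u n - l) < e
}.

#[short(type="cstarAlgType")]
HB.structure Definition CstarAlg (R : realType) :=
  {A of isCstarAlg R A & GRing.Algebra R[i] A}.

(* Complex Hilbert spaces; [inner] is linear in its first argument and
   conjugate-linear in its second one. *)
HB.mixin Record isHilbert (R : realType) (H : Type)
    of CompleteNormedModule R[i] H := {
  inner : {dot H for (Num.conj : R[i] -> R[i])};
  inner_norm : forall u : H, `|u| ^+ 2 = inner u u
}.

#[short(type="hilbertType")]
HB.structure Definition Hilbert (R : realType) :=
  {H of isHilbert R H & CompleteNormedModule R[i] H}.

(* Unital *-homomorphisms. *)
Definition star_morphism (R : realType) (A B : cstarAlgType R) (f : A -> B) :=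
  [/\ linear f, GRing.monoid_morphism f & {morph f : x / star x}].

(* The unital free product of copies of A indexed by nat (with amalgamated
   units), given by its universal property. *)
Record free_product (R : realType) (A : cstarAlgType R) := FreeProduct {
  fp_sort :> cstarAlgType R;
  fp_in : nat -> A -> fp_sort;
  fp_in_morphism : forall j : nat, star_morphism (fp_in j);
  fp_universal : forall (B : cstarAlgType R) (Phi : nat -> A -> B),
    (forall j : nat, star_morphism (Phi j)) ->
    exists! Psi : fp_sort -> B,
      star_morphism Psi /\ forall (j : nat) (a : A), Psi (fp_in j a) = Phi j a
}.

Arguments fp_in {R A} P j a : rename.
Arguments fp_in_morphism {R A} P j : rename.
Arguments fp_universal {R A} P {B Phi} PhiP : rename.

Section Endomorphisms.
Context (R : realType) (A : cstarAlgType R) (P : free_product A).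

Definition alpha (f : nat -> nat) : P -> P :=
  sval (cid (fp_universal P (fun j : nat => fp_in_morphism P (f j)))).

Lemma alpha_morphism f : star_morphism (alpha f).
Proof. by rewrite /alpha; case: cid => Psi [[]]. Qed.

Lemma alphaE f j a : alpha f (fp_in P j a) = fp_in P (f j) a.
Proof. by rewrite /alpha; case: cid => Psi [[_ /= ->]]. Qed.

Definition tau : P -> P := alpha succn.

Lemma tauE j a : tau (fp_in P j a) = fp_in P j.+1 a.
Proof. exact: alphaE. Qed.

End Endomorphisms.

Definition finitary_perm : set (nat -> nat) :=
  [set s : nat -> nat | bijective s /\ finite_set [set j | s j <> j]].

Definition cofinite_increasing : set (nat -> nat) :=
  [set h : nat -> nat | {homo h : i j / (i < j)%N} /\ finite_set (~` range h)].

Definition is_state (R : realType) (A : cstarAlgType R) (phi : {scalar A}) :=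
  (forall x : A, 0 <= phi (star x * x)) /\ phi 1 = 1.

Section Symmetries.
Context (R : realType) (A : cstarAlgType R) (P : free_product A).
Variable phi : {scalar P}.

Definition spreadable := forall h, cofinite_increasing h ->
  forall x : P, phi (alpha h x) = phi x.

Definition exchangeable := forall s, finitary_perm s ->
  forall x : P, phi (alpha s x) = phi x.

End Symmetries.

Section Operators.
Context (R : realType) (H : hilbertType R).

(* B(H) *)
Definition bounded_op : set (H -> H) :=
  [set T | linear T /\ continuous T].

Definition commutant (S : set (H -> H)) : set (H -> H) :=
  [set T | bounded_op T /\ forall s, S s -> T \o s = s \o T].

End Operators.

(* Unital *-representations on H. *)
Definition star_representation (R : realType) (A : cstarAlgType R)
    (H : hilbertType R) (rho : A -> H -> H) :=
  [/\ forall x, bounded_op (rho x),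
      forall (c : R[i]) (x y : A) (v : H),
        rho (c *: x + y) v = c *: rho x v + rho y v,
      rho 1 = id,
      forall x y : A, rho (x * y) = rho x \o rho y
    & forall (x : A) (u v : H), inner (rho (star x) u) v = inner u (rho x v)].

(* GNS triples of phi; for a state phi they exist and are unique up to unitary
   equivalence. *)
Record gns_triple (R : realType) (A : cstarAlgType R) (phi : {scalar A}) :=
  GnsTriple {
  gns_space :> hilbertType R;
  gns_rep : A -> gns_space -> gns_space;
  gns_vec : gns_space;
  gns_repP : star_representation gns_rep;
  gns_cyclic : closure (range (fun x : A => gns_rep x gns_vec)) = setT;
  gns_stateE : forall x : A, phi x = inner (gns_rep x gns_vec) gns_vec
}.

Arguments gns_rep {R A phi} G x v : rename.
Arguments gns_vec {R A phi} G : rename.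

Section FixedVectors.
Context (R : realType) (A : cstarAlgType R) (P : free_product A).
Context (phi : {scalar P}) (G : gns_triple phi).
Local Notation xi := (gns_vec G).

(* The isometry mapping [gns_rep G x xi] to [gns_rep G (theta x) xi] for all x.
   It exists and is unique if theta is a unital *-endomorphism leaving phi
   invariant, and it is then unitary if theta is moreover surjective.  The value
   of [get] is arbitrary when there is no such isometry. *)
Definition gns_isometry (theta : P -> P) : G -> G :=
  get [set V : G -> G | [/\ linear V, forall v, `|V v| = `|v|
    & forall x : P, V (gns_rep G x xi) = gns_rep G (theta x) xi]].

Definition fixed_tau : set G := [set v | gns_isometry (@tau R A P) v = v].

Definition fixed_J : set G :=
  [set v | forall h, cofinite_increasing h -> gns_isometry (alpha h) v = v].

Definition fixed_P : set G :=
  [set v | forall s, finitary_perm s -> gns_isometry (alpha s) v = v].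

Definition tail_algebra : set (G -> G) :=
  \bigcap_(n in [set: nat]) commutant (commutant
    [set T | exists k a, (n <= k)%N /\ T = gns_rep G (fp_in P k a)]).

Definition tail_vectors : set G := [set T xi | T in tail_algebra].

End FixedVectors.

Arguments fixed_tau {R A P phi} G _.
Arguments fixed_J {R A P phi} G _.
Arguments fixed_P {R A P phi} G _.
Arguments tail_algebra {R A P phi} G _.
Arguments tail_vectors {R A P phi} G _.

(* Main.v *)
Require Import Defs.
From HB Require Import structures.
From mathcomp Require Import all_boot all_order all_algebra.
From mathcomp Require Import complex.
From mathcomp Require Import all_classical reals interval_inference topology.
From mathcomp Require Import normedtype sequences.
From mathcomp Require Import zify ring lra.

(** Write P_m for the subalgebra generated by the copies of index less than m,
    Q_m for the one generated by the copies of index at least m, and K_m for the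
    closure of Q_m xi, which is the range of V_tau^m. Everything comes from
    comparing the fixed vectors of the symmetries with the intersection of the
    spaces K_m.

    Fixed by V_tau implies fixed by J: an h in J satisfies h(m + j) = m + c + j
    for some m and c ([cofinite_increasing_tail]), so that V_h v = V_h V_tau^m v
    = V_tau^(m + c) v = v.

    Tail vectors lie in every K_m: the projection onto K_m commutes with the
    copies of index at least m, hence with their bicommutant
    ([bicommutant_stable], [tail_algebra_space]).

    A vector v in every K_m is fixed by V_tau: for y in P_m, spreadability under
    the map that fixes 0, ..., m - 1 and adds 1 elsewhere gives <V_tau v, y xi>
    = <v, y xi>, and these vectors y xi, for all m, are dense
    ([tail_space_fixed_tau]). In the exchangeable case, v is also fixed by each
    U_s, since a finitary s moves no index beyond some m
    ([tail_space_fixed_perm]).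

    Fixed vectors are limits of tail vectors: for y and z in P_m, the number
    <tau^k(x) y xi, z xi> does not depend on k >= m, again by spreadability. The
    bounded sequence of operators tau^k(x) therefore has a weak limit T, which
    is in the tail algebra ([tail_limit]). If v is V_tau-fixed and x xi is
    within e of v, then so is every V_tau^k (x xi) = tau^k(x) xi, hence also T
    xi ([fixed_tau_closure_tail]).

    Lastly, a vector fixed by all U_s is V_tau-fixed: on P_m, tau coincides with
    alpha_s for the cycle s = (0 1 ... m) ([fixed_tau_P]).

    Two analytic facts are used throughout. Representations are contractive
    ([rep_contractive]), and the algebra generated by the copies is dense in the
    free product: its closure is a C*-algebra to which the universal property
    applies ([free_product_subalg], [gen_dense]). *)

Set Implicit Arguments.
Unset Strict Implicit.
Unset Printing Implicit Defensive.

Import Order.TTheory GRing.Theory Num.Theory numFieldNormedType.Exports.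

Local Open Scope classical_set_scope.
Local Open Scope complex_scope.
Local Open Scope ring_scope.

(** * Real-valued norms and epsilon characterizations *)

(** The norm of a normed space over R[i] takes its values in R[i], whose order
    is partial; infima, suprema and linear arithmetic need this real version. *)
Definition rnorm (R : realType) (V : normedZmodType R[i]) (v : V) : R :=
  complex.Re `|v|.

Section NormZmod.
Context (R : realType) (V : normedZmodType R[i]).
Implicit Types u v w : V.

Lemma rnormE v : `|v| = (rnorm v)%:C.
Proof. by rewrite /rnorm RRe_real // normr_real. Qed.

Lemma rnorm_ge0 v : 0 <= rnorm v.
Proof. by rewrite -ler0c -rnormE normr_ge0. Qed.

Lemma rnorm0 : rnorm (0 : V) = 0.
Proof. by rewrite /rnorm normr0. Qed.

Lemma rnorm0_eq0 v : rnorm v = 0 -> v = 0.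
Proof. by move=> v0; apply/eqP; rewrite -normr_eq0 rnormE v0. Qed.

Lemma ler_rnormD u v : rnorm (u + v) <= rnorm u + rnorm v.
Proof. by rewrite -lecR rmorphD /= -!rnormE ler_normD. Qed.

Lemma rnormN v : rnorm (- v) = rnorm v.
Proof. by rewrite /rnorm normrN. Qed.

Lemma rnorm_distC u v : rnorm (u - v) = rnorm (v - u).
Proof. by rewrite -rnormN opprB. Qed.

Lemma ler_rnorm_distD w u v : rnorm (u - v) <= rnorm (u - w) + rnorm (w - v).
Proof. by have := ler_rnormD (u - w) (w - v); rewrite addrA subrK. Qed.

Lemma ler_rnorm_dist_sub a b c d :
  rnorm (a - b - (c - d : V)) <= rnorm (a - c) + rnorm (b - d).
Proof.
by rewrite opprB [d - c]addrC addrACA [- b + d]addrC (rnorm_distC b) ler_rnormD.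
Qed.

Lemma rnorm_small_eq0 v : (forall e : R, 0 < e -> rnorm v < e) -> v = 0.
Proof.
move=> small; apply: rnorm0_eq0; apply/eqP; rewrite eq_le rnorm_ge0 andbT leNgt.
by apply/negP => /small; rewrite ltxx.
Qed.

End NormZmod.

Lemma ler_small (R : realType) (a b : R) :
  (forall e : R, 0 < e -> a <= b + e) -> a <= b.
Proof. by move=> ab; apply/ler_addgt0Pr. Qed.

Lemma invS_small (R : realType) (e : R) : 0 < e ->
  exists N : nat, forall n : nat, (N <= n)%N -> n.+1%:R^-1 < e.
Proof.
move=> e0; have := near_infty_natSinv_lt (PosNum e0).
by move=> [N _ NP]; exists N.
Qed.

Section NormMod.
Context (R : realType) (V : normedModType R[i]).
Implicit Types u v w : V.

Lemma rnormZ (a : R[i]) v : rnorm (a *: v) = rnorm a * rnorm v.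
Proof. by apply: complexI; rewrite rmorphM /= -!rnormE normrZ. Qed.

Lemma closure_rnorm (D : set V) v :
  closure D v <-> forall e : R, 0 < e -> exists2 d, D d & rnorm (v - d) < e.
Proof.
split=> [cDv e e0|Dv B /nbhs_ballP[/= e e0 eB]].
  have [|d [Dd]] := cDv (ball v e%:C).
    by apply: nbhsx_ballx; rewrite ltcR.
  rewrite -ball_normE /ball_ /= rnormE ltcR => vd.
  by exists d.
have eE : e = (complex.Re e)%:C by rewrite RRe_real // gtr0_real.
have e0' : 0 < complex.Re e by rewrite -ltcR -eE.
have [d Dd vd] := Dv _ e0'; exists d; split => //; apply: eB.
by rewrite -ball_normE /ball_ /= rnormE eE ltcR.
Qed.

End NormMod.

Lemma cauchy_rnorm (R : realType) (V : completeNormedModType R[i])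
    (u : nat -> V) :
  (forall e : R, 0 < e -> exists N : nat, forall m n : nat,
      (N <= m)%N -> (N <= n)%N -> rnorm (u m - u n) < e) ->
  exists l : V, forall e : R, 0 < e -> exists N : nat, forall n : nat,
      (N <= n)%N -> rnorm (u n - l) < e.
Proof.
move=> cu.
have : cauchy (u @ \oo).
  apply: cauchy_exP => e e0.
  have eE : e = (complex.Re e)%:C by rewrite RRe_real // gtr0_real.
  have e0' : 0 < complex.Re e by rewrite -ltcR -eE.
  have [N cN] := cu _ e0'; exists (u N), N => //= n Nn.
  by rewrite -ball_normE /ball_ /= rnormE eE ltcR cN.
move/cauchy_cvg => ul; exists (lim (u @ \oo)) => e e0.
have e0' : 0 < e%:C by rewrite ltcR.
have /cvgrPdist_lt/(_ _ e0')[N _ uN] := ul; exists N => n Nn.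
by have := uN n Nn; rewrite /= rnormE ltcR rnorm_distC.
Qed.

Section Linear.
Context (K : nzRingType) (V W : lmodType K) (T : V -> W).
Hypothesis linT : linear T.

Let Tl : {linear V -> W} := HB.pack T (GRing.isLinear.Build _ _ _ _ T linT).

Lemma lin0 : T 0 = 0. Proof. exact: (linear0 Tl). Qed.
Lemma linB : {morph T : x y / x - y}. Proof. exact: (linearB Tl). Qed.
Lemma linZ a : {morph T : x / a *: x}. Proof. exact: (linearZ_LR Tl a). Qed.

End Linear.

Section LinearBounded.
Context (R : realType) (V W : normedModType R[i]) (T : V -> W).
Hypothesis linT : linear T.

Let Tl : {linear V -> W} := HB.pack T (GRing.isLinear.Build _ _ _ _ T linT).

Lemma linear_bounded_rnorm :
  continuous T <-> exists2 C : R, 0 <= C & forall v, rnorm (T v) <= C * rnorm v.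
Proof.
split=> [cT|[C C0 TC]].
  have /linear_boundedP [M [Mr TM]] :=
    @continuous_linear_bounded _ _ _ 0 Tl (cT 0).
  have ME : M = (complex.Re M)%:C by rewrite RRe_real.
  pose C := `|complex.Re M| + 1.
  exists C => [|v]; first by rewrite addr_ge0.
  have /TM/(_ v) : M < C%:C.
    by rewrite ME ltcR (le_lt_trans (ler_norm _)) // ltrDl.
  by rewrite !rnormE -rmorphM lecR.
apply: (@bounded_linear_continuous _ _ _ Tl).
apply/linear_boundedP; exists C%:C; split; first by rewrite ger0_real ?ler0c.
move=> D CD v; have DE : D = (complex.Re D)%:C.
  by rewrite RRe_real // ger0_real // (le_trans _ (ltW CD)) // ler0c.
rewrite !rnormE DE -rmorphM lecR (le_trans (TC v)) // ler_wpM2r ?rnorm_ge0 //.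
by rewrite -lecR -DE ltW.
Qed.

End LinearBounded.

Lemma bounded_opP (R : realType) (H : hilbertType R) (T : H -> H) :
  bounded_op T <->
  linear T /\ exists2 C : R, 0 <= C & forall v, rnorm (T v) <= C * rnorm v.
Proof. by split=> -[lT] /(linear_bounded_rnorm lT). Qed.

(** * Hilbert spaces: projections and the Riesz representation *)
Section Inner.
Context (R : realType) (H : hilbertType R).
Implicit Types (u v w : H) (K : set H).

Lemma innerC u v : inner u v = Num.conj (inner v u).
Proof. by rewrite hermC /= expr0 mul1r. Qed.

Lemma innerDl u v w : inner (u + v) w = inner u w + inner v w.
Proof. exact: linearDl. Qed.

Lemma innerBl u v w : inner (u - v) w = inner u w - inner v w.
Proof. exact: linearBl. Qed.

Lemma innerZl a u v : inner (a *: u) v = a * inner u v.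
Proof. exact: linearZl_LR. Qed.

Lemma innerDr u v w : inner u (v + w) = inner u v + inner u w.
Proof. exact: linearDr. Qed.

Lemma innerBr u v w : inner u (v - w) = inner u v - inner u w.
Proof. exact: linearBr. Qed.

Lemma innerZr a u v : inner u (a *: v) = Num.conj a * inner u v.
Proof. exact: linearZr_LR. Qed.

Lemma inner_rnorm u : inner u u = (rnorm u ^+ 2)%:C.
Proof. by rewrite -inner_norm rnormE rmorphXn. Qed.

(** Removing from u its component along v: the source of the Cauchy-Schwarz
    inequality and of the orthogonality of a nearest point. *)
Lemma sub_line_rnorm u v : v != 0 ->
  rnorm (u - (inner u v / inner v v) *: v) ^+ 2
  = rnorm u ^+ 2 - rnorm (inner u v) ^+ 2 / rnorm v ^+ 2.
Proof.
move=> v0; apply: complexI.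
rewrite rmorphB /= (fmorph_div (real_complex R)) /= -!inner_rnorm.
have vv : inner v v != 0.
  rewrite inner_rnorm; apply: contra v0 => /eqP/complexI/eqP.
  by rewrite sqrf_eq0 => /eqP/rnorm0_eq0 ->.
have -> : (rnorm (inner u v) ^+ 2)%:C = inner u v * inner v u.
  by rewrite rmorphXn /= -rnormE normCK (innerC v u).
rewrite innerBl !innerBr !innerZl !innerZr.
have cvv : Num.conj (inner v v) = inner v v by rewrite -innerC.
rewrite rmorphM /= fmorphV /= cvv -!innerC.
by field.
Qed.

Lemma cauchy_schwarz u v : rnorm (inner u v) <= rnorm u * rnorm v.
Proof.
have [->|v0] := eqVneq v 0.
  rewrite (_ : inner u 0 = 0) ?rnorm0 ?mulr0 //.
  by rewrite -(scale0r u) innerZr rmorph0 mul0r.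
have nv : 0 < rnorm v.
  rewrite lt_def rnorm_ge0 andbT; apply: contra v0 => /eqP/rnorm0_eq0 -> //.
have := sqr_ge0 (rnorm (u - (inner u v / inner v v) *: v)).
rewrite sub_line_rnorm // subr_ge0 ler_pdivrMr ?exprn_gt0 // -exprMn.
by rewrite ler_pXn2r // nnegrE ?mulr_ge0 // rnorm_ge0.
Qed.

Lemma parallelogram u v :
  rnorm (u + v) ^+ 2 + rnorm (u - v) ^+ 2 = 2 * (rnorm u ^+ 2 + rnorm v ^+ 2).
Proof.
apply: complexI; rewrite rmorphM !rmorphD /= rmorph1 -!inner_rnorm.
rewrite innerBl innerDl !innerBr !innerDr; ring.
Qed.

Definition closed_subspace K :=
  [/\ K 0, forall a u v, K u -> K v -> K (a *: u + v) & closure K `<=` K].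

(** The projection of u is a nearest point p of K: by the parallelogram law a
    minimizing sequence is Cauchy, and p is orthogonal to K because otherwise
    [sub_line_rnorm] would produce a nearer point. *)
Lemma projection_ex K u : closed_subspace K ->
  exists2 p, K p & forall k, K k -> inner (u - p) k = 0.
Proof.
move=> [K0 KL Kcl].
pose E := [set rnorm (u - k) ^+ 2 | k in K].
have infE : has_inf E.
  split; first by exists (rnorm (u - 0) ^+ 2), 0.
  by exists 0 => _ [k _ <-]; exact: sqr_ge0.
pose d := inf E.
have d0 : 0 <= d.
  by apply: lb_le_inf => [|_ [k _ <-]]; [exact: infE.1|exact: sqr_ge0].
have dE k : K k -> d <= rnorm (u - k) ^+ 2.
  by move=> Kk; apply: ge_inf; [exact: infE.2|exists k].
have /choice[k kP] n : exists k, K k /\ rnorm (u - k) ^+ 2 < d + n.+1%:R^-1.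
  have [|_ [k Kk <-] kd] := @inf_adherent _ E n.+1%:R^-1 _ infE.
    by rewrite invr_gt0.
  by exists k.
have kk m n : rnorm (k m - k n) ^+ 2 <= 2 * (m.+1%:R^-1 + n.+1%:R^-1).
  have := parallelogram (u - k m) (u - k n).
  have -> : u - k m - (u - k n) = - (k m - k n).
    by rewrite !opprB addrC addrA subrK.
  have -> : u - k m + (u - k n) = 2 *: (u - 2^-1 *: (k m + k n)).
    rewrite scalerBr scalerA divff ?pnatr_eq0 // scale1r.
    by rewrite addrACA -opprD scaler_nat mulr2n.
  rewrite rnormN rnormZ exprMn.
  have -> : rnorm (2 : R[i]) = 2.
    by apply: complexI; rewrite -rnormE normr_nat rmorph_nat.
  have : d <= rnorm (u - 2^-1 *: (k m + k n)) ^+ 2.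
    apply: (dE); rewrite scalerDr; apply: (KL); first exact: (kP m).1.
    by rewrite -[X in K X]addr0; apply: (KL) => //; exact: (kP n).1.
  have := (kP m).2; have := (kP n).2.
  move: (rnorm (u - k m) ^+ 2) (rnorm (u - k n) ^+ 2) (rnorm (k m - k n) ^+ 2).
  move: (rnorm (u - 2^-1 *: (k m + k n)) ^+ 2) (m.+1%:R^-1) (n.+1%:R^-1).
  move=> a b c x y z. lra.
have [|p pP] := @cauchy_rnorm R H k.
  move=> e e0; have e4 : 0 < e ^+ 2 / 4 by rewrite divr_gt0 // exprn_gt0.
  have [N NP] := invS_small e4; exists N => m n Nm Nn.
  rewrite -(@ltr_pXn2r _ 2) // ?nnegrE ?rnorm_ge0 ?ltW //.
  rewrite (le_lt_trans (kk m n)) //.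
  have := NP _ Nm; have := NP _ Nn; move: (m.+1%:R^-1) (n.+1%:R^-1) => a b; lra.
have Kp : K p.
  apply: Kcl; apply/closure_rnorm => e /pP[N NP].
  exists (k N); first exact: (kP N).1.
  by rewrite rnorm_distC NP.
exists p => // x Kx.
(* The infimum is attained at the limit p. *)
have dp : rnorm (u - p) ^+ 2 <= d.
  have sqd : rnorm (u - p) <= Num.sqrt d.
    apply: ler_small => e e0; have e2 : 0 < e / 2 by rewrite divr_gt0.
    have [N1 P1] := pP _ e2.
    have [N2 P2] := invS_small (exprn_gt0 2 e2).
    pose N := maxn N1 N2.
    have := P1 N (leq_maxl _ _); have := P2 N (leq_maxr _ _) => h2 h1.
    have := ler_rnorm_distD (k N) u p.
    suff : rnorm (u - k N) <= Num.sqrt d + e / 2 by lra.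
    rewrite -(@ler_pXn2r _ 2) // ?nnegrE ?rnorm_ge0 //; last first.
      by rewrite addr_ge0 ?sqrtr_ge0 // ltW.
    have := (kP N).2; rewrite sqrrD sqr_sqrtr //.
    have : 0 <= Num.sqrt d * (e / 2) by rewrite mulr_ge0 ?sqrtr_ge0 // ltW.
    by move: h2; rewrite mulr2n; move: (N.+1%:R^-1) (_ ^+ 2) => a b; lra.
  rewrite -(sqr_sqrtr d0) ler_pXn2r // nnegrE ?rnorm_ge0 ?sqrtr_ge0 //.
have [->|x0] := eqVneq x 0.
  by rewrite -(scale0r p) innerZr rmorph0 mul0r.
have := sub_line_rnorm (u - p) x0; set a := _ / _.
rewrite -addrA -opprD => ax.
have : d <= rnorm (u - (p + a *: x)) ^+ 2.
  by apply: (dE); rewrite addrC; apply: (KL).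
rewrite ax => le1.
have : rnorm (inner (u - p) x) ^+ 2 / rnorm x ^+ 2 <= 0 by lra.
rewrite ler_pdivrMr ?mul0r; last first.
  rewrite exprn_gt0 // lt_def rnorm_ge0 andbT.
  by apply: contra x0 => /eqP/rnorm0_eq0 ->.
move=> le2; apply: rnorm0_eq0; apply/eqP; rewrite -sqrf_eq0.
by rewrite eq_le le2 sqr_ge0.
Qed.

(** If f is not zero, a vector orthogonal to its kernel represents it up to a
    scalar. *)
Lemma riesz (f : H -> R[i]) (C : R) : scalar f ->
  (forall v, rnorm (f v) <= C * rnorm v) -> exists w, forall v, f v = inner v w.
Proof.
move=> lf fC.
have fB u v : f (u - v) = f u - f v.
  by rewrite addrC -scaleN1r lf mulN1r addrC.
have [f0|] := pselect (forall v, f v = 0).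
  by exists 0 => v; rewrite f0 -(scale0r v) innerZr rmorph0 mul0r.
move=> /existsNP[u /eqP fu].
have f00 : f 0 = 0 by rewrite -(subrr u) fB subrr.
have [|p /= fp pP] := @projection_ex [set v | f v = 0] u.
  split => //= [a x y fx fy|x /closure_rnorm fx /=].
    by rewrite lf fx fy mulr0 addr0.
  apply: rnorm_small_eq0 => e e0.
  have C1 : 0 < `|C| + 1 by rewrite ltr_wpDl.
  have [y /= fy] := fx _ (divr_gt0 e0 C1).
  rewrite ltr_pdivlMr // => xy.
  rewrite -[f x]subr0 -fy -fB (le_lt_trans (fC _)) // (le_lt_trans _ xy) //.
  rewrite mulrC ler_wpM2l ?rnorm_ge0 //; have := ler_norm C; lra.
set z := u - p in pP.
have fz : f z != 0 by rewrite fB fp subr0.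
have zz : inner z z != 0.
  rewrite inner_rnorm; apply: contra fz => /eqP/complexI/eqP.
  by rewrite sqrf_eq0 => /eqP/rnorm0_eq0 ->; rewrite f00.
exists (Num.conj (f z / inner z z) *: z) => v.
have /pP : f (v - (f v / f z) *: z) = 0.
  by rewrite addrC -scaleNr lf mulNr divfK // addNr.
move/(congr1 Num.conj); rewrite -innerC rmorph0 innerBl innerZl => /eqP.
rewrite subr_eq0 => /eqP vz.
by rewrite innerZr conjCK vz; field; rewrite ?zz ?fz.
Qed.

Lemma adjoint_ex (S : H -> H) v : bounded_op S ->
  exists z, forall x, inner (S x) v = inner x z.
Proof.
move=> /bounded_opP[lS [C C0 SC]].
apply: (@riesz _ (C * rnorm v)) => [a x y|x].
  by rewrite lS innerDl innerZl.
by rewrite (le_trans (cauchy_schwarz _ _)) // mulrAC ler_wpM2r ?rnorm_ge0.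
Qed.

End Inner.

(** * Weak convergence *)
Section Weak.
Context (R : realType) (H : hilbertType R).
Implicit Types (u v w l : H) (s t : nat -> H).

Definition wcvg s l := forall v (e : R), 0 < e ->
  exists N : nat, forall k, (N <= k)%N -> rnorm (inner v (s k) - inner v l) < e.

Lemma inner_eq0 l : (forall v, inner v l = 0) -> l = 0.
Proof.
move=> /(_ l); rewrite inner_rnorm => /complexI/eqP.
by rewrite sqrf_eq0 => /eqP/rnorm0_eq0.
Qed.

Lemma wcvg_unique s l l' : wcvg s l -> wcvg s l' -> l = l'.
Proof.
move=> sl sl'; apply/eqP; rewrite -subr_eq0; apply/eqP/inner_eq0 => v.
rewrite innerBr; apply: rnorm_small_eq0 => e e0.
have e2 : 0 < e / 2 by rewrite divr_gt0.
have [N P] := sl v _ e2; have [N' P'] := sl' v _ e2.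
have := ler_rnorm_distD (inner v (s (maxn N N'))) (inner v l) (inner v l').
have := P _ (leq_maxl N N'); have := P' _ (leq_maxr N N').
rewrite (rnorm_distC (inner v l) (inner v (s _))); lra.
Qed.

Lemma wcvg_lin s t l m (a : R[i]) : wcvg s l -> wcvg t m ->
  wcvg (fun k => a *: s k + t k) (a *: l + m).
Proof.
move=> sl tm v e e0.
have a1 : 0 < rnorm a + 1 by rewrite ltr_wpDl ?rnorm_ge0.
have e2 : 0 < e / 2 by rewrite divr_gt0.
have [N P] := sl v _ (divr_gt0 e2 a1); have [N' P'] := tm v _ e2.
exists (maxn N N') => k; rewrite geq_max => /andP[/P + /P'].
rewrite ltr_pdivlMr // !innerDr !innerZr.
have -> : Num.conj a * inner v (s k) + inner v (t k)
    - (Num.conj a * inner v l + inner v m)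
  = Num.conj a * (inner v (s k) - inner v l)
    + (inner v (t k) - inner v m) by ring.
move=> h1 h2; apply: (le_lt_trans (ler_rnormD _ _)).
have -> : rnorm (Num.conj a * (inner v (s k) - inner v l))
   = rnorm a * rnorm (inner v (s k) - inner v l).
  by apply: complexI; rewrite rmorphM /= -!rnormE normrM norm_conjC.
have := rnorm_ge0 (inner v (s k) - inner v l); nra.
Qed.

(** The adjoint of S moves S to the other side of the inner product. *)
Lemma wcvg_bounded_op (S : H -> H) s l : bounded_op S -> wcvg s l ->
  wcvg (S \o s) (S l).
Proof.
move=> bS sl v e e0; have [z zP] := adjoint_ex v bS.
have [N P] := sl z _ e0; exists N => k /P.
suff E : rnorm (inner v (S (s k)) - inner v (S l))
   = rnorm (inner z (s k) - inner z l) by rewrite /= E.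
by rewrite !(innerC v) !zP -!innerC.
Qed.

(** Closed balls are weakly closed. *)
Lemma wcvg_le s l u (C : R) : wcvg s l -> (forall k, rnorm (s k - u) <= C) ->
  rnorm (l - u) <= C.
Proof.
move=> sl sC; have [->|n0] := eqVneq (rnorm (l - u)) 0.
  exact: le_trans (rnorm_ge0 _) (sC 0%N).
have {n0}n0 : 0 < rnorm (l - u) by rewrite lt_def n0 rnorm_ge0.
rewrite -(ler_pM2l n0) -expr2; apply: ler_small => e e0.
have [N P] := sl (l - u) _ e0; have := P N (leqnn N).
have -> : rnorm (l - u) ^+ 2 = rnorm (inner (l - u) (l - u)).
  by apply: complexI; rewrite inner_rnorm -rnormE ger0_norm // ler0c sqr_ge0.
have -> : inner (l - u) (l - u) = inner (l - u) (s N - u)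
    - (inner (l - u) (s N) - inner (l - u) l).
  by rewrite !(innerBr (l - u)); ring.
move=> h; apply: (le_trans (ler_rnormD _ _)).
rewrite rnormN lerD // ?(ltW h) //.
by rewrite (le_trans (cauchy_schwarz _ _)) // ler_wpM2l // rnorm_ge0.
Qed.

Lemma wcvg_eventually (n : nat) s t l :
  (forall k, (n <= k)%N -> s k = t k) -> wcvg s l -> wcvg t l.
Proof.
move=> st sl v e /(sl v)[N P]; exists (maxn n N) => k.
by rewrite geq_max => /andP[/st <- /P].
Qed.

Lemma rnorm_complex_le (z : R[i]) :
  rnorm z <= `|complex.Re z| + `|complex.Im z|.
Proof.
rewrite /rnorm normc_def /=.
rewrite -(@ler_pXn2r _ 2) // ?nnegrE ?sqrtr_ge0 ?addr_ge0 //.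
rewrite sqr_sqrtr ?addr_ge0 ?sqr_ge0 // sqrrD !real_normK ?num_real //.
by rewrite lerD2r lerDl mulrn_wge0 // mulr_ge0.
Qed.

Lemma Re_le_rnorm (z : R[i]) : `|complex.Re z| <= rnorm z.
Proof.
rewrite /rnorm normc_def /= -(@ler_pXn2r _ 2) // ?nnegrE ?sqrtr_ge0 //.
rewrite sqr_sqrtr ?addr_ge0 ?sqr_ge0 // !real_normK ?num_real //.
by rewrite lerDl sqr_ge0.
Qed.

Lemma Im_le_rnorm (z : R[i]) : `|complex.Im z| <= rnorm z.
Proof.
rewrite /rnorm normc_def /= -(@ler_pXn2r _ 2) // ?nnegrE ?sqrtr_ge0 //.
rewrite sqr_sqrtr ?addr_ge0 ?sqr_ge0 // !real_normK ?num_real //.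
by rewrite lerDr sqr_ge0.
Qed.

Lemma cauchy_real (x : nat -> R) :
  (forall e : R, 0 < e -> exists N : nat, forall m n : nat,
      (N <= m)%N -> (N <= n)%N -> `|x m - x n| < e) ->
  exists l : R, forall e : R, 0 < e -> exists N : nat, forall n : nat,
      (N <= n)%N -> `|x n - l| < e.
Proof.
move=> cx.
have : cauchy (x @ \oo).
  apply: cauchy_exP => e e0.
  have [N cN] := cx _ e0; exists (x N), N => //= n Nn.
  by rewrite -ball_normE /ball_ /= cN.
move/cauchy_cvg => xl; exists (lim (x @ \oo)) => e e0.
have /cvgrPdist_lt/(_ _ e0)[N _ xN] := xl; exists N => n Nn.
by rewrite distrC; exact: xN.
Qed.

Lemma cauchy_complex (x : nat -> R[i]) :
  (forall e : R, 0 < e -> exists N : nat, forall m n : nat,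
      (N <= m)%N -> (N <= n)%N -> rnorm (x m - x n) < e) ->
  exists l : R[i], forall e : R, 0 < e -> exists N : nat, forall n : nat,
      (N <= n)%N -> rnorm (x n - l) < e.
Proof.
move=> cx.
have [|a aP] := @cauchy_real (fun n => complex.Re (x n)).
  move=> e /cx[N P]; exists N => m n Nm Nn; rewrite -raddfB.
  by rewrite (le_lt_trans (Re_le_rnorm _)) // P.
have [|b bP] := @cauchy_real (fun n => complex.Im (x n)).
  move=> e /cx[N P]; exists N => m n Nm Nn; rewrite -raddfB.
  by rewrite (le_lt_trans (Im_le_rnorm _)) // P.
exists (a +i* b) => e e0; have e2 : 0 < e / 2 by rewrite divr_gt0.
have [N P] := aP _ e2; have [N' P'] := bP _ e2.
exists (maxn N N') => k; rewrite geq_max => /andP[/P h /P' h'].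
rewrite (le_lt_trans (rnorm_complex_le _)) // !raddfB /=; lra.
Qed.

(** Boundedness extends the convergence of the inner products from a dense set
    to all of H; the limit is a bounded linear functional, so the Riesz theorem
    provides the weak limit. *)
Lemma wcvg_ex (D : set H) s (C : R) : closure D = setT ->
  (forall k, rnorm (s k) <= C) ->
  (forall v (e : R), D v -> 0 < e -> exists (N : nat) (c : R[i]), forall k,
     (N <= k)%N -> rnorm (inner v (s k) - c) < e) ->
  exists l, wcvg s l.
Proof.
move=> Dd sC Ds.
have C0 : 0 <= C := le_trans (rnorm_ge0 _) (sC 0%N).
have /choice[f fP] v : exists l : R[i], forall e : R, 0 < e ->
    exists N : nat, forall n : nat, (N <= n)%N -> rnorm (inner v (s n) - l) < e.
  apply: cauchy_complex => e e0.
  have C1 : 0 < C + 1 by rewrite ltr_wpDl.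
  have e4 : 0 < e / 4 by rewrite divr_gt0.
  have : closure D v by rewrite Dd.
  move=> /closure_rnorm/(_ _ (divr_gt0 e4 C1))[d Dd' ].
  have [N [c Nc]] := Ds d _ Dd' e4.
  rewrite ltr_pdivlMr // => vd; exists N.
  have close k : (N <= k)%N -> rnorm (inner v (s k) - c) < e / 2.
    move=> /Nc dc; have := ler_rnorm_distD (inner d (s k)) (inner v (s k)) c.
    rewrite -innerBl; have := cauchy_schwarz (v - d) (s k).
    have : rnorm (v - d) * rnorm (s k) <= rnorm (v - d) * (C + 1).
      by rewrite ler_wpM2l ?rnorm_ge0 // (le_trans (sC _)) // lerDl.
    lra.
  move=> m n /close hm /close hn.
  have := ler_rnorm_distD c (inner v (s m)) (inner v (s n)).
  rewrite (rnorm_distC c); lra.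
have fC v : rnorm (f v) <= C * rnorm v.
  apply: ler_small => e /(fP v)[N P]; have := P _ (leqnn N).
  have := cauchy_schwarz v (s N).
  have := ler_rnormD (inner v (s N)) (f v - inner v (s N)).
  rewrite addrC subrK (rnorm_distC (f v)).
  have : rnorm v * rnorm (s N) <= C * rnorm v.
    by rewrite mulrC ler_wpM2r ?rnorm_ge0.
  lra.
have lf : scalar f.
  move=> a u v; apply/eqP; rewrite -subr_eq0; apply/eqP.
  apply: rnorm_small_eq0 => e e0.
  have a1 : 0 < rnorm a + 1 by rewrite ltr_wpDl ?rnorm_ge0.
  have e3 : 0 < e / 3 by rewrite divr_gt0.
  have [N1 P1] := fP (a *: u + v) _ e3.
  have [N2 P2] := fP u _ (divr_gt0 e3 a1).
  have [N3 P3] := fP v _ e3.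
  pose N := maxn N1 (maxn N2 N3).
  have := P1 N (leq_maxl _ _).
  have /P2 : (N2 <= N)%N by rewrite /N !leq_max leqnn orbT.
  have /P3 : (N3 <= N)%N by rewrite /N !leq_max leqnn !orbT.
  rewrite innerDl innerZl; clearbody N.
  set x := inner u _; set y := inner v _ => h3; rewrite ltr_pdivlMr // => h2 h1.
  have -> : f (a *: u + v) - (a * f u + f v) =
    (f (a *: u + v) - (a * x + y)) + (a * (x - f u) + (y - f v)) by ring.
  have := ler_rnormD (f (a *: u + v) - (a * x + y)) (a * (x - f u) + (y - f v)).
  have := ler_rnormD (a * (x - f u)) (y - f v).
  have -> : rnorm (a * (x - f u)) = rnorm a * rnorm (x - f u).
    by apply: complexI; rewrite rmorphM /= -!rnormE normrM.
  move: h1; rewrite (rnorm_distC (_ + y)); have := rnorm_ge0 (x - f u). nra.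
have [l lP] := riesz lf fC; exists l => v e e0.
by have [N P] := fP v _ e0; exists N => k /P; rewrite lP.
Qed.

End Weak.

(** * Contractivity of star representations *)
Section CstarNorm.
Context (R : realType) (A : cstarAlgType R).
Implicit Types x y z : A.

Lemma cnorm0 : cnorm (0 : A) = 0.
Proof. by apply: complexI; rewrite -(scale0r (0 : A)) cnormZ normr0 mul0r. Qed.

Lemma cnormN x : cnorm (- x) = cnorm x.
Proof. by apply: complexI; rewrite -scaleN1r cnormZ normrN1 mul1r. Qed.

Lemma cnorm_distC x y : cnorm (x - y) = cnorm (y - x).
Proof. by rewrite -cnormN opprB. Qed.

Lemma ler_cnorm_distD z x y : cnorm (x - y) <= cnorm (x - z) + cnorm (z - y).
Proof. by have := ler_cnormD (x - z) (z - y); rewrite addrA subrK. Qed.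

Lemma cnorm_ge0 x : 0 <= cnorm x.
Proof. by have := ler_cnormD x (- x); rewrite subrr cnorm0 cnormN; lra. Qed.

Lemma cnorm_star_le x : cnorm x <= cnorm (star x).
Proof.
have [->|x0] := eqVneq (cnorm x) 0; first exact: cnorm_ge0.
have {x0}x0 : 0 < cnorm x by rewrite lt_def x0 cnorm_ge0.
by rewrite -(ler_pM2r x0) -expr2 -cnorm_starM ler_cnormM.
Qed.

Lemma cnorm_star x : cnorm (star x) = cnorm x.
Proof.
by apply/eqP; rewrite eq_le cnorm_star_le andbT -{2}(starK x) cnorm_star_le.
Qed.

Lemma star1 : star (1 : A) = 1.
Proof. by have := starM (star (1 : A)) 1; rewrite starK !mulr1 starK. Qed.

Lemma starN x : star (- x) = - star x.
Proof. by rewrite -scaleN1r starZ rmorphN rmorph1 scaleN1r. Qed.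

(** The inverse is the sum of the geometric series of z. *)
Lemma neumann z : cnorm z < 1 -> exists b, b * (1 - z) = 1.
Proof.
set q := cnorm z => q1; have q0 : 0 <= q := cnorm_ge0 z.
pose s n := \sum_(i < n) z ^+ i.
have sS n : s n.+1 = s n + z ^+ n by rewrite /s big_ord_recr.
have sz n : s n * (1 - z) = 1 - z ^+ n.
  elim: n => [|n IH]; first by rewrite /s big_ord0 mul0r expr0 subrr.
  by rewrite sS mulrDl IH mulrBr mulr1 -exprSr addrA subrK.
pose c := cnorm (1 : A); have c0 : 0 <= c := cnorm_ge0 1.
have zn n : cnorm (z ^+ n) <= c * q ^+ n.
  elim: n => [|n IH]; first by rewrite !expr0 mulr1.
  rewrite !exprSr mulrA (le_trans (ler_cnormM _ _)) // ler_wpM2r //.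
have tail n k :
    (1 - q) * cnorm (s (n + k)%N - s n) <= c * q ^+ n - c * q ^+ (n + k).
  elim: k => [|k IH]; first by rewrite addn0 !subrr cnorm0 mulr0.
  have := ler_cnormD (s (n + k)%N - s n) (z ^+ (n + k)).
  rewrite addnS sS addrAC => h.
  have q1' : 0 <= 1 - q by lra.
  apply: (le_trans (ler_wpM2l q1' h)); rewrite exprS mulrDr.
  have := ler_wpM2l q1' (zn (n + k)%N); lra.
have small (e : R) : 0 < e -> exists N : nat, c * q ^+ N < e.
  move=> e0; have c1 : 0 < c + 1 by rewrite ltr_wpDl.
  have qN : (fun n => q ^+ n) @ \oo --> (0 : R).
    by apply: cvg_expr; rewrite ger0_norm.
  have /cvgrPdist_lt/(_ _ (divr_gt0 e0 c1))[N _ /(_ N (leqnn N))] := qN.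
  rewrite /= sub0r normrN ger0_norm ?exprn_ge0 // ltr_pdivlMr // => h.
  by exists N; have := exprn_ge0 N q0; lra.
have tail' (e : R) : 0 < e -> exists N : nat, forall n, (N <= n)%N ->
    cnorm (s n - s N) < e.
  move=> e0; have q1' : 0 < 1 - q by lra.
  have [N NP] := small _ (mulr_gt0 e0 q1'); exists N => n Nn.
  have := tail N (n - N)%N; rewrite subnKC // => h.
  have : 0 <= c * q ^+ n by rewrite mulr_ge0 ?exprn_ge0.
  rewrite -(ltr_pM2l q1'); lra.
have [b bP] : exists b : A, forall e : R, 0 < e ->
    exists N : nat, forall n : nat, (N <= n)%N -> cnorm (s n - b) < e.
  apply: cnorm_complete => e e0; have e2 : 0 < e / 2 by rewrite divr_gt0.
  have [N P] := tail' _ e2; exists N => m n /P hm /P hn.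
  have := ler_cnorm_distD (s N) (s m) (s n).
  rewrite (cnorm_distC (s N) (s n)); lra.
exists b; apply/eqP; rewrite -subr_eq0; apply/eqP/cnorm0_eq0.
apply/eqP; rewrite eq_le cnorm_ge0 andbT; apply: ler_small => e e0.
have e2 : 0 < e / 2 by rewrite divr_gt0.
pose d := cnorm (1 - z) + 1; have d0 : 0 < d by rewrite ltr_wpDl ?cnorm_ge0.
have [N P] := bP _ (divr_gt0 e2 d0); have [M Q] := small _ e2.
pose n := maxn N M; have := P n (leq_maxl _ _).
have Qn : c * q ^+ n <= c * q ^+ M.
  by rewrite ler_wpM2l // ler_wiXn2l ?leq_maxr // ltW.
rewrite ltr_pdivlMr // /d => h.
have -> : b * (1 - z) - 1 = (b - s n) * (1 - z) - z ^+ n.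
  by rewrite mulrBl sz opprB [z ^+ n - 1]addrC addrA addrK.
have := ler_cnormD ((b - s n) * (1 - z)) (- z ^+ n).
have := ler_cnormM (b - s n) (1 - z).
rewrite cnormN (cnorm_distC b); have := zn n; have := cnorm_ge0 (s n - b); lra.
Qed.

End CstarNorm.

Section StarRep.
Context (R : realType) (A : cstarAlgType R) (H : hilbertType R).
Context (rho : A -> H -> H).
Hypothesis rhoP : star_representation rho.

Lemma rep_bounded x : bounded_op (rho x). Proof. by case: rhoP. Qed.

Lemma rep_linear x : linear (rho x). Proof. by case: (rep_bounded x). Qed.

Lemma rep_lin c x y v : rho (c *: x + y) v = c *: rho x v + rho y v.
Proof. by case: rhoP. Qed.

Lemma rep1 v : rho 1 v = v. Proof. by case: rhoP => _ _ ->. Qed.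

Lemma repM x y v : rho (x * y) v = rho x (rho y v).
Proof. by case: rhoP => _ _ _ ->. Qed.

Lemma rep_star x u v : inner (rho (star x) u) v = inner u (rho x v).
Proof. by case: rhoP. Qed.

Lemma rep0 v : rho 0 v = 0.
Proof.
by have := rep_lin (-1) 0 0 v; rewrite scaler0 addr0 scaleN1r addNr.
Qed.

Lemma repZ c x v : rho (c *: x) v = c *: rho x v.
Proof. by rewrite -[c *: x]addr0 rep_lin rep0 addr0. Qed.

Lemma repB x y v : rho (x - y) v = rho x v - rho y v.
Proof. by rewrite addrC -scaleN1r rep_lin scaleN1r addrC. Qed.

(** Let M be the square of the operator norm of rho x, which is the norm of rho
    (x^* x). The number M is an approximate eigenvalue of rho (x^* x): along
    vectors u of the unit ball such that |rho x u|^2 tends to M, the vectors u -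
    M^-1 rho (x^* x) u tend to 0. If M were larger than the squared norm of x,
    then 1 - M^-1 x^* x would have a left inverse b by [neumann], and rho b
    would send vectors tending to 0 to these u, whose norms stay away from 0. *)
Lemma rep_contractive x v : rnorm (rho x v) <= cnorm x * rnorm v.
Proof.
pose E := [set rnorm (rho x v) ^+ 2 | v in [set v | rnorm v <= 1]].
have supE : has_sup E.
  split; first by exists (rnorm (rho x 0) ^+ 2), 0 => //=; rewrite rnorm0.
  have /bounded_opP[_ [C C0 xC]] := rep_bounded x.
  exists (C ^+ 2) => _ [u /= u1 <-]; rewrite ler_pXn2r // ?nnegrE ?rnorm_ge0 //.
  by rewrite (le_trans (xC u)) // ler_piMr.
pose M := sup E.
have xM u : rnorm (rho x u) ^+ 2 <= M * rnorm u ^+ 2.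
  have [/rnorm0_eq0 ->|u0] := eqVneq (rnorm u) 0.
    by rewrite (lin0 (rep_linear x)) rnorm0 expr0n mulr0.
  have {u0}u0 : 0 < rnorm u by rewrite lt_def u0 rnorm_ge0.
  have nu : rnorm (rnorm u)^-1%:C = (rnorm u)^-1.
    by apply: complexI; rewrite -rnormE ger0_norm // ler0c invr_ge0 rnorm_ge0.
  have : rnorm (rho x ((rnorm u)^-1%:C *: u)) ^+ 2 <= M.
    apply: ub_le_sup; first exact: supE.2.
    by exists ((rnorm u)^-1%:C *: u) => //=; rewrite rnormZ nu mulVf ?gt_eqF.
  rewrite (linZ (rep_linear x)) rnormZ nu exprMn exprVn mulrC.
  by rewrite ler_pdivrMr // exprn_gt0.
suff Mx : M <= cnorm x ^+ 2.
  rewrite -(@ler_pXn2r _ 2) // ?nnegrE ?mulr_ge0 ?rnorm_ge0 ?cnorm_ge0 //.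
  by rewrite exprMn (le_trans (xM v)) // ler_wpM2r ?sqr_ge0.
(* The scalar r = M^-1 makes r *: (x^* x) a strict contraction. *)
rewrite leNgt; apply/negP => xltM.
have M0 : 0 < M := le_lt_trans (sqr_ge0 _) xltM.
pose r : R[i] := (M^-1)%:C.
have nr_r : `|r| = r by rewrite ger0_norm // ler0c invr_ge0 ltW.
have [|b bP] := @neumann R A (r *: (star x * x)).
  rewrite (_ : cnorm _ = M^-1 * cnorm x ^+ 2) ?ltr_pdivrMl ?mulr1 //.
  by apply: complexI; rewrite cnormZ nr_r cnorm_starM -rmorphM.
have /bounded_opP[_ [C C0 bC]] := rep_bounded b.
have key u :
    rnorm u ^+ 2 <= C ^+ 2 * (rnorm u ^+ 2 - M^-1 * rnorm (rho x u) ^+ 2).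
  pose w := rho (1 - r *: (star x * x)) u.
  have uw : rnorm u <= C * rnorm w by rewrite -{1}(rep1 u) -bP repM bC.
  have wE : w = u - r *: rho (star x) (rho x u).
    by rewrite /w repB rep1 repZ repM.
  set S := rho (star x) (rho x u) in wE.
  have uS : inner u S = (rnorm (rho x u) ^+ 2)%:C.
    by rewrite innerC rep_star -innerC inner_rnorm.
  have SS : rnorm S ^+ 2 <= M * rnorm (rho x u) ^+ 2.
    have [->|S0] := eqVneq (rnorm S) 0.
      by rewrite expr0n mulr_ge0 ?sqr_ge0 // ltW.
    have {S0}S0 : 0 < rnorm S by rewrite lt_def S0 rnorm_ge0.
    have : rnorm S ^+ 2 <= rnorm (rho x u) * rnorm (rho x S).
      apply: le_trans (cauchy_schwarz _ _).
      by rewrite -rep_star -/S inner_rnorm /rnorm ger0_norm ?ler0c ?sqr_ge0.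
    have h1 := xM S.
    rewrite -(@ler_pXn2r _ 2) ?nnegrE ?mulr_ge0 ?sqr_ge0 ?rnorm_ge0 //.
    rewrite exprMn => h2.
    rewrite -(@ler_pM2r _ (rnorm S ^+ 2)) ?exprn_gt0 //.
    have := ler_wpM2l (sqr_ge0 (rnorm (rho x u))) h1; lra.
  have -> : rnorm u ^+ 2 - M^-1 * rnorm (rho x u) ^+ 2 =
      rnorm u ^+ 2 - 2 * M^-1 * rnorm (rho x u) ^+ 2
      + M^-1 ^+ 2 * (M * rnorm (rho x u) ^+ 2).
    by field; rewrite gt_eqF.
  have wS : rnorm w ^+ 2 = rnorm u ^+ 2 - 2 * M^-1 * rnorm (rho x u) ^+ 2
      + M^-1 ^+ 2 * rnorm S ^+ 2.
    apply: complexI; rewrite -inner_rnorm wE innerBl !innerBr !innerZl !innerZr.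
    rewrite (innerC S u) uS !inner_rnorm.
    have rC (t : R) : Num.conj t%:C = t%:C.
      by rewrite conj_Creal // complex_real.
    by rewrite !rC /r !(rmorphD, rmorphB, rmorphM, rmorphXn, rmorph1) /=; ring.
  apply: (@le_trans _ _ ((C * rnorm w) ^+ 2)).
    by rewrite ler_pXn2r // nnegrE ?mulr_ge0 ?rnorm_ge0.
  by rewrite exprMn wS ler_wpM2l ?sqr_ge0 // lerD2l ler_wpM2l ?sqr_ge0.
have C2 : 0 < C ^+ 2 + 1 by rewrite ltr_wpDl ?sqr_ge0.
(* The slack M / (C ^+ 2 + 1) is small enough to contradict [key]. *)
have [_ [y [/= y1 <-]]] := @sup_adherent _ E _ (divr_gt0 M0 C2) supE.
rewrite -/M => yM.
have y2 : rnorm y ^+ 2 <= 1 by rewrite expr_le1 ?rnorm_ge0.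
have tM : 1 - (C ^+ 2 + 1)^-1 < M^-1 * rnorm (rho x y) ^+ 2.
  by rewrite ltr_pdivlMl // mulrBr mulr1.
have ty : M^-1 * rnorm (rho x y) ^+ 2 <= rnorm y ^+ 2.
  by rewrite ler_pdivrMl // xM.
have := key y; have c2 := sqr_ge0 C.
have CC : (C ^+ 2 + 1) * (C ^+ 2 + 1)^-1 = 1 by rewrite divff ?gt_eqF.
have := ler_wpM2l c2 y2; have := ler_wpM2l c2 (ltW tM).
move: tM ty y2; move: (rnorm y ^+ 2) (M^-1 * _) => p t.
move: (C ^+ 2) ((C ^+ 2 + 1)^-1) c2 CC => c d.
nra.
Qed.

End StarRep.

Lemma star_representation_comp (R : realType) (A B : cstarAlgType R)
    (H : hilbertType R) (f : A -> B) (rho : B -> H -> H) :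
  star_representation rho -> star_morphism f ->
  star_representation (fun x => rho (f x)).
Proof.
move=> [rB rL r1 rM rS] [fL [f1 fM] fS]; split=> [x|c x y v||x y|x u v].
- exact: rB.
- by rewrite fL rL.
- by rewrite f1.
- by rewrite fM.
- by rewrite fS.
Qed.

(** * Density of the generated algebra in the free product *)

(** Norm-closed star-subalgebras, bundled so that the associated subtype can
    carry a C*-algebra structure and serve as a target of the universal
    property. *)
Record cstar_subalg (R : realType) (A : cstarAlgType R) := CstarSubalg {
  subalg_pred : {pred A};
  subalg_subsemialg : GRing.subsemialg_closed subalg_pred;
  subalg_star : forall x, x \in subalg_pred -> star x \in subalg_pred;
  subalg_complete : forall x,
    (forall e : R, 0 < e -> exists2 y, y \in subalg_pred & cnorm (x - y) < e) ->
    x \in subalg_pred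
}.

Section SubCstar.
Context (R : realType) (A : cstarAlgType R) (S : cstar_subalg A).

Definition sub_cstar := {x : A | x \in subalg_pred S}.

HB.instance Definition _ := SubChoice.on sub_cstar.
HB.instance Definition _ :=
  GRing.SubChoice_isSubAlgebra.Build _ _ _ sub_cstar (subalg_subsemialg S).

Definition sub_star (x : sub_cstar) : sub_cstar :=
  exist _ (star (val x)) (subalg_star (valP x)).

Definition sub_cnorm (x : sub_cstar) : R := cnorm (val x).

Lemma sub_starK : involutive sub_star.
Proof. by move=> x; apply: val_inj; rewrite /= starK. Qed.

Lemma sub_starD : {morph sub_star : x y / x + y}.
Proof. by move=> x y; apply: val_inj; rewrite /= starD. Qed.

Lemma sub_starZ (a : R[i]) (x : sub_cstar) :
  sub_star (a *: x) = Num.conj a *: sub_star x.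
Proof. by apply: val_inj; rewrite /= starZ. Qed.

Lemma sub_starM (x y : sub_cstar) : sub_star (x * y) = sub_star y * sub_star x.
Proof. by apply: val_inj; rewrite /= starM. Qed.

Lemma sub_cnorm0_eq0 (x : sub_cstar) : sub_cnorm x = 0 -> x = 0.
Proof. by move=> /cnorm0_eq0 x0; apply: val_inj. Qed.

Lemma sub_cnorm_complete (u : nat -> sub_cstar) :
    (forall e : R, 0 < e -> exists N : nat, forall m n : nat,
      (N <= m)%N -> (N <= n)%N -> sub_cnorm (u m - u n) < e) ->
    exists l : sub_cstar, forall e : R, 0 < e -> exists N : nat, forall n : nat,
      (N <= n)%N -> sub_cnorm (u n - l) < e.
Proof.
move=> /(@cnorm_complete _ _ (fun n => val (u n)))[l lP].
have Sl : l \in subalg_pred S.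
  apply: subalg_complete => e /lP[N NP]; exists (val (u N)); first exact: valP.
  by rewrite cnorm_distC NP.
by exists (exist _ l Sl).
Qed.

HB.instance Definition _ := isCstarAlg.Build R sub_cstar sub_starK sub_starD
  sub_starZ sub_starM sub_cnorm0_eq0 (fun x y => ler_cnormD (val x) (val y))
  (fun a x => cnormZ a (val x)) (fun x y => ler_cnormM (val x) (val y))
  (fun x => cnorm_starM (val x)) sub_cnorm_complete.

Lemma sub_val_morphism : star_morphism (val : sub_cstar -> A).
Proof. by []. Qed.

End SubCstar.

Section FreeProduct.
Context (R : realType) (A : cstarAlgType R) (P : free_product A).

Lemma star_morphism_comp (B C D : cstarAlgType R) (f : B -> C) (g : C -> D) :
  star_morphism f -> star_morphism g -> star_morphism (g \o f).
Proof.
move=> [fL [f1 fM] fS] [gL [g1 gM] gS]; split=> [a x y /=||x /=].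
- by rewrite fL gL.
- by split=> [|x y] /=; rewrite ?f1 ?fM.
- by rewrite fS gS.
Qed.

Lemma star_morphism_id (B : cstarAlgType R) : star_morphism (@id B).
Proof. by []. Qed.

(** Both f and g are the map given by the universal property. *)
Lemma free_product_ext (B : cstarAlgType R) (f g : P -> B) :
  star_morphism f -> star_morphism g ->
  (forall j a, f (fp_in P j a) = g (fp_in P j a)) -> f = g.
Proof.
move=> fP gP fg.
have [h [_ hU]] := fp_universal P (Phi := fun j => g \o fp_in P j)
  (fun j => star_morphism_comp (fp_in_morphism P j) gP).
by rewrite -(hU f) ?(hU g).
Qed.

Lemma alpha_comp f g (x : P) : alpha f (alpha g x) = alpha (f \o g) x.
Proof.
rewrite -[LHS]/((alpha f \o alpha g) x); congr (_ x).
apply: free_product_ext; [|exact: alpha_morphism|].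
  by apply: star_morphism_comp; exact: alpha_morphism.
by move=> j a; rewrite /= !alphaE.
Qed.

Lemma alpha_id (x : P) : alpha id x = x.
Proof.
rewrite -[RHS]/(id x); congr (_ x).
apply: free_product_ext; [exact: alpha_morphism|exact: star_morphism_id|].
by move=> j a; rewrite alphaE.
Qed.

(** The universal property maps P into S over the copies of A; followed by the
    inclusion of S, this is an endomorphism of P fixing the copies, that is, the
    identity. *)
Lemma free_product_subalg (S : cstar_subalg P) :
  (forall j a, fp_in P j a \in subalg_pred S) -> forall x, x \in subalg_pred S.
Proof.
move=> SP.
pose Phi j a : sub_cstar S := exist _ (fp_in P j a) (SP j a).
have PhiP j : star_morphism (Phi j).
  have [fL [f1 fM] fS] := fp_in_morphism P j; split=> [a x y||x].
  - by apply: val_inj; rewrite /= fL.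
  - by split=> [|x y]; apply: val_inj; rewrite /= ?f1 ?fM.
  - by apply: val_inj; rewrite /= fS.
have [Psi [[PsiM PsiE] _]] := fp_universal P PhiP.
have := @free_product_ext _ (val \o Psi) id
  (star_morphism_comp PsiM (sub_val_morphism S)) (@star_morphism_id _).
move=> E x; have <- : val (Psi x) = x.
  by rewrite -[RHS]/(id x) -E // => j a; rewrite /= PsiE.
exact: valP.
Qed.

Inductive generated (S : set nat) : P -> Prop :=
| gen_in j a : S j -> generated S (fp_in P j a)
| gen1 : generated S 1
| gen_lin c x y : generated S x -> generated S y -> generated S (c *: x + y)
| gen_mul x y : generated S x -> generated S y -> generated S (x * y).

Lemma gen_mono (S T : set nat) x : S `<=` T -> generated S x -> generated T x.
Proof.
move=> ST; elim=> {x} [j a Sj||c x y _ xP _ yP|x y _ xP _ yP].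
- exact/gen_in/ST.
- exact: gen1.
- exact: gen_lin.
- exact: gen_mul.
Qed.

Lemma gen_star (S : set nat) x : generated S x -> generated S (star x).
Proof.
elim=> {x} [j a Sj||c x y _ xP _ yP|x y _ xP _ yP].
- by have [_ _ <-] := fp_in_morphism P j; exact: gen_in.
- by rewrite star1; exact: gen1.
- by rewrite starD starZ; exact: gen_lin.
- by rewrite starM; exact: gen_mul.
Qed.

(** In particular alpha f fixes the algebra generated by the copies whose index
    is fixed by f. *)
Lemma gen_alpha_eq (S : set nat) (f g : nat -> nat) x :
  (forall j, S j -> f j = g j) -> generated S x -> alpha f x = alpha g x.
Proof.
move=> fg; have [fL [f1 fM] _] := alpha_morphism P f.
have [gL [g1 gM] _] := alpha_morphism P g.
elim=> {x} [j a Sj||c x y _ xP _ yP|x y _ xP _ yP].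
- by rewrite !alphaE fg.
- by rewrite f1 g1.
- by rewrite fL gL xP yP.
- by rewrite fM gM xP yP.
Qed.

Lemma gen_finite x : generated setT x ->
  exists m : nat, generated [set j | (j < m)%N] x.
Proof.
have maxl m n : [set j | (j < m)%N] `<=` [set j | (j < maxn m n)%N].
  by move=> j /= jm; rewrite leq_max jm.
have maxr m n : [set j | (j < n)%N] `<=` [set j | (j < maxn m n)%N].
  by move=> j /= jm; rewrite leq_max jm orbT.
elim=> {x} [j a _||c x y _ [m xP] _ [n yP]|x y _ [m xP] _ [n yP]].
- by exists j.+1; apply: gen_in => /=.
- by exists 0%N; exact: gen1.
- by exists (maxn m n); apply: gen_lin; [exact: gen_mono xP|exact: gen_mono yP].
- by exists (maxn m n); apply: gen_mul; [exact: gen_mono xP|exact: gen_mono yP].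
Qed.

Definition gen_closure : {pred P} := fun x =>
  `[< forall e : R, 0 < e -> exists2 y, generated setT y & cnorm (x - y) < e >].

Lemma gen_closureP x : reflect
  (forall e : R, 0 < e -> exists2 y, generated setT y & cnorm (x - y) < e)
  (x \in gen_closure).
Proof. exact: asboolP. Qed.

Lemma gen_gen_closure x : generated setT x -> x \in gen_closure.
Proof.
by move=> xP; apply/gen_closureP => e e0; exists x; rewrite ?subrr ?cnorm0.
Qed.

Lemma gen_closure_subalg : GRing.subsemialg_closed gen_closure.
Proof.
apply: GRing.subalg_closed_semi; split.
- exact/gen_gen_closure/gen1.
- move=> c x y /gen_closureP xP /gen_closureP yP; apply/gen_closureP => e e0.
  have c1 : 0 < rnorm c + 1 by rewrite ltr_wpDl ?rnorm_ge0.
  have e2 : 0 < e / 2 by rewrite divr_gt0.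
  have [x' x'P] := xP _ (divr_gt0 e2 c1); have [y' y'P yy'] := yP _ e2.
  rewrite ltr_pdivlMr // => xx'.
  exists (c *: x' + y'); first exact: gen_lin.
  have -> : c *: x + y - (c *: x' + y') = c *: (x - x') + (y - y').
    by rewrite scalerBr opprD addrACA.
  have := ler_cnormD (c *: (x - x')) (y - y').
  have -> : cnorm (c *: (x - x')) = rnorm c * cnorm (x - x').
    by apply: complexI; rewrite cnormZ rmorphM /= rnormE.
  have := cnorm_ge0 (x - x'); lra.
- move=> x y /gen_closureP xP /gen_closureP yP; apply/gen_closureP => e e0.
  have e2 : 0 < e / 2 by rewrite divr_gt0.
  have y1 : 0 < cnorm y + 1 by rewrite ltr_wpDl ?cnorm_ge0.
  have [x' x'P] := xP _ (divr_gt0 e2 y1).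
  have x1 : 0 < cnorm x' + 1 by rewrite ltr_wpDl ?cnorm_ge0.
  have [y' y'P] := yP _ (divr_gt0 e2 x1).
  rewrite !ltr_pdivlMr // => yy' xx'; exists (x' * y'); first exact: gen_mul.
  have -> : x * y - x' * y' = (x - x') * y + x' * (y - y').
    by rewrite mulrBl mulrBr addrA subrK.
  have := ler_cnormD ((x - x') * y) (x' * (y - y')).
  have := ler_cnormM (x - x') y; have := ler_cnormM x' (y - y').
  have := cnorm_ge0 (x - x'); have := cnorm_ge0 (y - y'); lra.
Qed.

Lemma gen_closure_star x : x \in gen_closure -> star x \in gen_closure.
Proof.
move=> /gen_closureP xP; apply/gen_closureP => e /xP[y yP xy].
exists (star y); first exact: gen_star.
by rewrite -starN -starD cnorm_star.
Qed.

Lemma gen_closure_complete x :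
    (forall e : R, 0 < e -> exists2 y, y \in gen_closure & cnorm (x - y) < e) ->
    x \in gen_closure.
Proof.
move=> xP; apply/gen_closureP => e e0; have e2 : 0 < e / 2 by rewrite divr_gt0.
have [y /gen_closureP/(_ _ e2)[z zP yz] xy] := xP _ e2; exists z => //.
have := ler_cnorm_distD y x z; lra.
Qed.

Lemma gen_dense x (e : R) : 0 < e ->
  exists2 y, generated setT y & cnorm (x - y) < e.
Proof.
move: x e.
suff E x : x \in gen_closure by move=> x; exact/gen_closureP.
apply: (@free_product_subalg (CstarSubalg gen_closure_subalg gen_closure_star
  gen_closure_complete)) => j a.
exact/gen_gen_closure/gen_in.
Qed.

End FreeProduct.

(** * Extension from dense subspaces *)
Section Lipschitz.
Context (R : realType).

Lemma lipschitz_eq0 (V W : normedModType R[i]) (D : set V) (f : V -> W)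
    (C : R) v :
  (forall u w, rnorm (f u - f w) <= C * rnorm (u - w)) ->
  (forall d, D d -> f d = 0) -> closure D v -> f v = 0.
Proof.
move=> fC fD /closure_rnorm Dv; apply: rnorm_small_eq0 => e e0.
have C1 : 0 < `|C| + 1 by rewrite ltr_wpDl.
have [d /fD fd] := Dv _ (divr_gt0 e0 C1); rewrite ltr_pdivlMr // => vd.
have := fC v d; rewrite fd subr0.
have := rnorm_ge0 (v - d); have := ler_norm C; nra.
Qed.

Lemma dense_inner_eq0 (H : hilbertType R) (D : set H) (l : H) :
  closure D = setT -> (forall d, D d -> inner d l = 0) -> l = 0.
Proof.
move=> Dd Dl; apply: inner_eq0 => v.
have Dv : closure D v by rewrite Dd.
apply: (@lipschitz_eq0 H R[i]^o D (inner^~ l) (rnorm l) v) => // u w.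
by rewrite -innerBl mulrC cauchy_schwarz.
Qed.

(** The value of V at v is the point w whose distance to each k x is at most
    that of v to j x: such a w is the limit of the k (x n) whenever the j (x n)
    tend to v, and this property alone yields that V is linear and isometric. *)
Lemma isometry_extension (A : lmodType R[i]) (H : hilbertType R)
    (j k : A -> H) : linear j -> linear k ->
  closure (range j) = setT -> (forall x, rnorm (k x) = rnorm (j x)) ->
  exists V : H -> H, [/\ linear V, forall v, rnorm (V v) = rnorm v
    & forall x, V (j x) = k x].
Proof.
move=> jL kL jd kj.
have jB x y : j x - j y = j (x - y).
  by rewrite ![_ - y]addrC -scaleN1r jL scaleN1r addrC.
have kB x y : k x - k y = k (x - y).
  by rewrite ![_ - y]addrC -scaleN1r kL scaleN1r addrC.
have jdP v (e : R) : 0 < e -> exists x, rnorm (v - j x) < e.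
  move=> e0; have : closure (range j) v by rewrite jd.
  by move=> /closure_rnorm/(_ _ e0)[_ [x _ <-]]; exists x.
have /choice[V VP] v : exists w, forall x, rnorm (w - k x) <= rnorm (v - j x).
  have /choice[x xP] n : exists x, rnorm (v - j x) < n.+1%:R^-1.
    by apply: jdP; rewrite invr_gt0.
  have [|w wP] := @cauchy_rnorm R H (fun n => k (x n)).
    move=> e e0; have e2 : 0 < e / 2 by rewrite divr_gt0.
    have [N NP] := invS_small e2; exists N => m n /NP Nm /NP Nn.
    rewrite kB kj -jB; have := ler_rnorm_distD v (j (x m)) (j (x n)).
    rewrite (rnorm_distC _ v); have := xP m; have := xP n.
    move: Nm Nn; move: (m.+1%:R^-1) (n.+1%:R^-1) => a b; lra.
  exists w => y; apply: ler_small => e e0.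
  have e2 : 0 < e / 2 by rewrite divr_gt0.
  have [N NP] := invS_small e2; have [M MP] := wP _ e2.
  have := NP _ (leq_maxl N M); have := MP _ (leq_maxr N M).
  move: (maxn N M) => n h1 h2; have := xP n.
  have := ler_rnorm_distD (k (x n)) w (k y).
  rewrite kB kj -jB (rnorm_distC w (k (x n))).
  have := ler_rnorm_distD v (j (x n)) (j y); rewrite (rnorm_distC _ v).
  move: h2; move: (n.+1%:R^-1) => a; lra.
have Vj x : V (j x) = k x.
  apply/eqP; rewrite -subr_eq0; apply/eqP/rnorm0_eq0/eqP.
  by rewrite eq_le rnorm_ge0 andbT (le_trans (VP _ _)) // subrr rnorm0.
exists V; split => // [a u v|v].
- apply/eqP; rewrite -subr_eq0; apply/eqP; apply: rnorm_small_eq0 => e e0.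
  have a1 : 0 < rnorm a + 1 by rewrite ltr_wpDl ?rnorm_ge0.
  have e4 : 0 < e / 4 by rewrite divr_gt0.
  have [x] := jdP u _ (divr_gt0 e4 a1); rewrite ltr_pdivlMr // => ux.
  have [y vy] := jdP v _ e4.
  have h1 := VP (a *: u + v) (a *: x + y).
  have h2 := VP u x; have h3 := VP v y; rewrite kL jL in h1.
  have E (u1 v1 u2 v2 : H) :
      rnorm (a *: u1 + v1 - (a *: u2 + v2))
      <= rnorm a * rnorm (u1 - u2) + rnorm (v1 - v2).
    by rewrite opprD addrACA -scalerBr (le_trans (ler_rnormD _ _)) // rnormZ.
  have := E u v (j x) (j y); have := E (V u) (V v) (k x) (k y).
  have := ler_rnorm_distD (a *: k x + k y) (V (a *: u + v)) (a *: V u + V v).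
  rewrite (rnorm_distC (a *: k x + k y) (a *: V u + V v)).
  have := rnorm_ge0 (u - j x); have := rnorm_ge0 a; nra.
- have j0 : j 0 = 0 by rewrite -(subrr 0) -jB subrr.
  have k0 : k 0 = 0 by rewrite -(subrr 0) -kB subrr.
  apply/eqP; rewrite eq_le; apply/andP; split.
    by have := VP v 0; rewrite j0 k0 !subr0.
  apply: ler_small => e e0; have e2 : 0 < e / 2 by rewrite divr_gt0.
  have [x vx] := jdP v _ e2; have h := VP v x.
  have := ler_rnorm_distD (j x) v 0; rewrite !subr0 -kj.
  have := ler_rnorm_distD (V v) (k x) 0.
  rewrite !subr0 (rnorm_distC (k x) (V v)); lra.
Qed.

End Lipschitz.

(** * Invariant subspaces of bicommutants *)
Section Bicommutant.
Context (R : realType) (H : hilbertType R) (S : set (H -> H)) (K : set H).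

(** As S is closed under adjoints, the orthogonal complement of K is S-invariant
    too; thus the projection p onto K is in the commutant of S and commutes with
    T, so that T v = T (p v) = p (T v). *)
Lemma bicommutant_stable : closed_subspace K ->
  (forall s, S s -> linear s /\ exists2 s', S s' &
     forall u v, inner (s u) v = inner u (s' v)) ->
  (forall s v, S s -> K v -> K (s v)) ->
  forall T v, commutant (commutant S) T -> K v -> K (T v).
Proof.
move=> Kc Sstar SK T v [_ TS] Kv.
have [K0 KL Kcl] := Kc.
have /choice[p pP] u : exists q, K q /\ forall k, K k -> inner (u - q) k = 0.
  by have [q] := projection_ex u Kc; exists q.
(* Being characterized by orthogonality, p u can be identified by exhibiting a
   candidate q: this gives linearity and the commutation with S. *)
have p_unique u q : K q -> (forall k, K k -> inner (u - q) k = 0) -> p u = q.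
  move=> Kq qP; have [Kpu puP] := pP u.
  have Kd : K (p u - q) by rewrite addrC -scaleN1r; exact: KL.
  apply/eqP; rewrite -subr_eq0; apply/eqP/rnorm0_eq0/eqP.
  rewrite -sqrf_eq0 -(inj_eq (@complexI R)) -inner_rnorm.
  rewrite {1}(_ : p u - q = (u - q) - (u - p u)); last first.
    by rewrite opprB [RHS]addrC addrA subrK.
  by rewrite innerBl qP // puP // subrr.
have pL : linear p.
  move=> a x y; apply: p_unique.
    by apply: KL; [exact: (pP x).1|exact: (pP y).1].
  move=> k Kk; rewrite opprD addrACA -scalerBr innerDl innerZl.
  by rewrite (pP x).2 // (pP y).2 // mulr0 addr0.
have pB : bounded_op p.
  apply/bounded_opP; split => //; exists 1 => // u; rewrite mul1r.
  have [Kpu puP] := pP u.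
  have [->|n0] := eqVneq (rnorm (p u)) 0; first exact: rnorm_ge0.
  have {n0}n0 : 0 < rnorm (p u) by rewrite lt_def n0 rnorm_ge0.
  rewrite -(ler_pM2r n0); apply: le_trans (cauchy_schwarz _ _).
  have := puP _ Kpu; rewrite innerBl => /eqP; rewrite subr_eq0 => /eqP ->.
  by rewrite inner_rnorm /rnorm ger0_norm ?ler0c ?sqr_ge0.
have pS : commutant S p.
  split=> // s Ss; have [sL [s' Ss' ss']] := Sstar s Ss.
  apply/funext => u /=; apply: p_unique.
    by apply: SK => //; exact: (pP u).1.
  by move=> k Kk; rewrite -(linB sL) ss' (pP u).2 //; exact: SK.
have -> : v = p v.
  by rewrite (p_unique v v) // => k _; rewrite subrr -(scale0r v) innerZl mul0r.
by have /(congr1 (fun f => f v)) /= -> := TS p pS; exact: (pP _).1.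
Qed.

End Bicommutant.

(** * Vectors and isometries of the GNS representation *)
Section Gns.
Context (R : realType) (A : cstarAlgType R).
Context (phi : {scalar A}) (G : gns_triple phi).
Local Notation xi := (gns_vec G).
Local Notation vec x := (gns_rep G x (gns_vec G)).

Lemma vec_lin c x y : vec (c *: x + y) = c *: vec x + vec y.
Proof. by rewrite (rep_lin (gns_repP G)). Qed.

Lemma vec1 : vec 1 = xi. Proof. exact: rep1 (gns_repP G) _. Qed.

Lemma vecM x y : vec (x * y) = gns_rep G x (vec y).
Proof. exact: repM (gns_repP G) _ _ _. Qed.

Lemma inner_vec x y : inner (vec x) (vec y) = phi (star y * x).
Proof. by rewrite (gns_stateE G) vecM (rep_star (gns_repP G)). Qed.

Lemma rnorm_vec x : rnorm (vec x) ^+ 2 = complex.Re (phi (star x * x)).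
Proof. by rewrite -inner_vec inner_rnorm. Qed.

Lemma rnorm_vec_le x : rnorm (vec x) <= cnorm x * rnorm xi.
Proof. exact: rep_contractive (gns_repP G) _ _. Qed.

Lemma gns_isometry_ex (theta : A -> A) : star_morphism theta ->
  (forall x, phi (theta x) = phi x) ->
  exists V : G -> G, [/\ linear V, forall v, rnorm (V v) = rnorm v
    & forall x, V (vec x) = vec (theta x)].
Proof.
move=> [tL [t1 tM] tS] tphi; apply: isometry_extension.
- by move=> c x y; rewrite vec_lin.
- by move=> c x y; rewrite tL vec_lin.
- exact: gns_cyclic.
- move=> x; apply/eqP; rewrite -(@eqrXn2 _ 2) ?rnorm_ge0 // !rnorm_vec.
  by rewrite -tS -tM tphi.
Qed.

End Gns.

(** * Maps of the index set *)
Lemma cofinite_addn m : cofinite_increasing (addn m).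
Proof.
split=> [i j ij|]; first by rewrite ltn_add2l.
apply: (sub_finite_set _ (finite_II m)) => j /= jr; rewrite ltnNge.
by apply/negP => mj; apply: jr; exists (j - m)%N => //; rewrite subnKC.
Qed.

(** Spreading along this map leaves the copies of index less than m in place
    while moving the others k steps away. *)
Definition gap m k j := if (j < m)%N then j else (j + k)%N.

Lemma cofinite_gap m k : cofinite_increasing (gap m k).
Proof.
split=> [i j ij|]; first by rewrite /gap; do !case: ifP; lia.
apply: (sub_finite_set _ (finite_II (m + k))) => j /= jr; rewrite ltnNge.
apply/negP => mj; apply: jr; exists (j - k)%N => //.
by rewrite /gap; do !case: ifP; lia.
Qed.

Lemma finite_set_nat_bounded (S : set nat) : finite_set S ->
  exists b : nat, forall j, (b <= j)%N -> ~ S j.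
Proof.
move=> /finite_seqP[s ->]; exists (\max_(i <- s) i).+1 => j + /= js.
by rewrite ltnNge => /negP; apply; exact: leq_bigmax_seq js isT.
Qed.

(** Beyond the last missing value b, h cannot skip a value, so it increases by
    exactly 1 at each step. *)
Lemma cofinite_increasing_tail h : cofinite_increasing h ->
  exists m c, forall j, h (m + j)%N = (m + c + j)%N.
Proof.
move=> [hinc /finite_set_nat_bounded[b bP]].
have hge j : (j <= h j)%N.
  by elim: j => // j IH; exact: leq_ltn_trans IH (hinc j j.+1 (ltnSn j)).
exists b, (h b - b)%N; elim=> [|j IH]; first by rewrite !addn0 subnKC.
have := hinc (b + j)%N (b + j.+1)%N; rewrite addnS ltnSn => /(_ isT) hlt.
have /bP/contrapT[i _ hi] : (b <= (h (b + j)).+1)%N.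
  by have := hge (b + j)%N; lia.
have bi : (b + j < i)%N.
  rewrite ltnNge; apply/negP; rewrite leq_eqVlt => /predU1P[ib|/hinc].
    by rewrite ib in hi; lia.
  by rewrite hi; lia.
have : (h (b + j).+1 <= h i)%N.
  by move: bi; rewrite leq_eqVlt => /predU1P[-> //|/hinc/ltnW].
by rewrite hi; lia.
Qed.

(** The cycle (0 1 ... m), which agrees with the shift on 0, ..., m - 1. *)
Definition rotation m j :=
  if (j < m)%N then j.+1 else if j == m then 0%N else j.

Lemma finitary_rotation m : finitary_perm (rotation m).
Proof.
pose f j := if j == 0%N then m else if (j <= m)%N then j.-1 else j.
split; first by exists f => j; rewrite /f /rotation; do !case: ifP; lia.
apply: (sub_finite_set _ (finite_II m.+1)) => j /= jr; rewrite ltnNge.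
by apply/negP => mj; apply: jr; rewrite /rotation; do !case: ifP; lia.
Qed.

Lemma finitary_shift s : finitary_perm s ->
  exists m, forall j, s (m + j)%N = (m + j)%N.
Proof.
move=> [_ /finite_set_nat_bounded[m mP]]; exists m => j.
by apply: contrapT; apply: mP; rewrite leq_addr.
Qed.

(** * Tail spaces *)
Section Operators.
Context (R : realType) (A : cstarAlgType R) (P : free_product A).
Context (phi : {scalar P}) (G : gns_triple phi).
Local Notation xi := (gns_vec G).
Local Notation vec x := (gns_rep G x (gns_vec G)).
Local Notation Vop h := (@gns_isometry R A P phi G (alpha h)).

Definition preserves (h : nat -> nat) := forall x : P, phi (alpha h x) = phi x.

Lemma gns_isometryP h : preserves h ->
  [/\ linear (Vop h), forall v, rnorm (Vop h v) = rnorm v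
    & forall x, Vop h (vec x) = vec (alpha h x)].
Proof.
move=> ph; have [V [VL Vn Vv]] := gns_isometry_ex G (alpha_morphism P h) ph.
have := @getPex _ [set V : G -> G | [/\ linear V, forall v, `|V v| = `|v|
    & forall x : P, V (vec x) = vec (alpha h x)]].
case=> [|WL Wn Wv]; first by exists V; split => // v; rewrite !rnormE Vn.
by split => // v; rewrite /rnorm Wn.
Qed.

Lemma Vop_vec h x : preserves h -> Vop h (vec x) = vec (alpha h x).
Proof. by case/gns_isometryP. Qed.

Lemma Vop_dist h u v : preserves h -> rnorm (Vop h u - Vop h v) = rnorm (u - v).
Proof. by case/gns_isometryP => VL Vn _; rewrite -(linB VL) Vn. Qed.

Lemma Vop_id_lipschitz h u v : preserves h ->
  rnorm (Vop h u - u - (Vop h v - v)) <= 2 * rnorm (u - v).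
Proof.
move=> ph; apply: le_trans (ler_rnorm_dist_sub _ _ _ _) _.
by rewrite Vop_dist //; lra.
Qed.

(** The fixed vectors of an isometry form a closed set. *)
Lemma Vop_fixed_closure h (D : set G) v : preserves h ->
  (forall d, D d -> Vop h d = d) -> closure D v -> Vop h v = v.
Proof.
move=> ph Dh Dv; apply/eqP; rewrite -subr_eq0; apply/eqP.
apply: (@lipschitz_eq0 _ _ _ D (fun v => Vop h v - v) 2 v) => // [u w|d /Dh ->].
  exact: Vop_id_lipschitz.
exact: subrr.
Qed.

Lemma Vop_comp f g v : preserves f -> preserves g -> preserves (f \o g) ->
  Vop f (Vop g v) = Vop (f \o g) v.
Proof.
move=> pf pg pfg; apply/eqP; rewrite -subr_eq0; apply/eqP.
have vd : closure (range (fun x => vec x)) v by rewrite gns_cyclic.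
apply: (lipschitz_eq0 (f := fun v => Vop f (Vop g v) - Vop (f \o g) v)
  (C := 2) _ _ vd).
  move=> u w; apply: le_trans (ler_rnorm_dist_sub _ _ _ _) _.
  by rewrite !Vop_dist //; lra.
by move=> _ [x _ <-]; rewrite !Vop_vec // alpha_comp subrr.
Qed.

Definition generated_vectors : set G :=
  [set vec x | x in [set x : P | exists m, generated `I_m x]].

Lemma generated_vectors_dense : closure generated_vectors = setT.
Proof.
apply/seteqP; split => // v _; apply/closure_rnorm => e e0.
have e2 : 0 < e / 2 by rewrite divr_gt0.
have : closure (range (fun x => vec x)) v by rewrite gns_cyclic.
move=> /closure_rnorm/(_ _ e2)[_ [x _ <-] vx].
have n1 : 0 < rnorm xi + 1 by rewrite ltr_wpDl ?rnorm_ge0.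
have [y /gen_finite[m ym]] := gen_dense x (divr_gt0 e2 n1).
rewrite ltr_pdivlMr // => xy; exists (vec y); first by exists y => //; exists m.
have := ler_rnorm_distD (vec x) v (vec y).
rewrite -(repB (gns_repP G) x).
have := rnorm_vec_le G (x - y); have := cnorm_ge0 (x - y); lra.
Qed.

(* tail subspaces *)
(** This is the range of V_tau^m: the image of alpha (addn m) is the subalgebra
    of the copies of index at least m. *)
Definition tail_space m : set G :=
  closure (range (fun x => vec (alpha (addn m) x))).

Lemma tail_space_closed m : closed_subspace (tail_space m).
Proof.
have [aL _ _] := alpha_morphism P (addn m).
split.
- apply: subset_closure; exists 0 => //.
  by rewrite (lin0 aL) (rep0 (gns_repP G)).
- move=> a u v /closure_rnorm uP /closure_rnorm vP; apply/closure_rnorm => e e0.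
  have a1 : 0 < rnorm a + 1 by rewrite ltr_wpDl ?rnorm_ge0.
  have e2 : 0 < e / 2 by rewrite divr_gt0.
  have [_ [x _ <-]] := uP _ (divr_gt0 e2 a1); rewrite ltr_pdivlMr // => ux.
  have [_ [y _ <-] vy] := vP _ e2.
  exists (vec (alpha (addn m) (a *: x + y))); first by exists (a *: x + y).
  rewrite aL vec_lin opprD addrACA -scalerBr.
  apply: le_lt_trans (ler_rnormD _ _) _; rewrite rnormZ.
  have := rnorm_ge0 (u - vec (alpha (addn m) x)); lra.
- by rewrite -(closure_id _).1 //; exact: closed_closure.
Qed.

(** The cyclic vector lies in K_m, which is invariant under the copies of index
    at least m. *)
Lemma tail_algebra_space T m : tail_algebra G T -> tail_space m (T xi).
Proof.
move=> /(_ m I) TP; have [_ [a1 _] _] := alpha_morphism P (addn m).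
apply: (bicommutant_stable (tail_space_closed m) _ _ TP).
- move=> _ [k [a [mk ->]]]; split; first exact: rep_linear (gns_repP G) _.
  have [_ _ iS] := fp_in_morphism P k.
  exists (gns_rep G (fp_in P k (star a))); first by exists k, (star a).
  by move=> u v; rewrite -(rep_star (gns_repP G)) -iS starK.
- move=> _ v [k [a [mk ->]]] /closure_rnorm vP; apply/closure_rnorm => e e0.
  have /bounded_opP[sL [C C0 sC]] := rep_bounded (gns_repP G) (fp_in P k a).
  have C1 : 0 < C + 1 by rewrite ltr_wpDl.
  have [_ [x _ <-]] := vP _ (divr_gt0 e0 C1); rewrite ltr_pdivlMr // => vx.
  have [_ [_ aM] _] := alpha_morphism P (addn m).
  exists (vec (alpha (addn m) (fp_in P (k - m) a * x))).
    by exists (fp_in P (k - m) a * x).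
  rewrite aM alphaE subnKC // vecM -(linB sL).
  have := sC (v - vec (alpha (addn m) x)).
  have := rnorm_ge0 (v - vec (alpha (addn m) x)); lra.
- by apply: subset_closure; exists 1 => //; rewrite a1 vec1.
Qed.

(** * Fixed vectors of spreadable and exchangeable states *)
Section Spreadable.
Hypothesis spr : spreadable phi.

Lemma preserves_addn m : preserves (addn m).
Proof. exact/spr/cofinite_addn. Qed.

Lemma preserves_tau : preserves succn.
Proof. exact: preserves_addn 1. Qed.

Lemma fixed_tau_addn m v : fixed_tau G v -> Vop (addn m) v = v.
Proof.
move=> tv; elim: m => [|m IH].
  apply: (Vop_fixed_closure (D := generated_vectors) (preserves_addn 0)).
    by move=> _ [x _ <-]; rewrite (Vop_vec _ (preserves_addn 0)) alpha_id.
  by rewrite generated_vectors_dense.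
have -> : addn m.+1 = succn \o addn m by apply/funext => j /=; rewrite addSn.
rewrite -Vop_comp ?IH //; [exact: preserves_tau|exact: preserves_addn|].
exact: (preserves_addn m.+1).
Qed.

Lemma fixed_tau_J : fixed_tau G = fixed_J G.
Proof.
apply/seteqP; split => v tv; last exact: (tv succn (cofinite_addn 1)).
move=> h hJ; have [m [c hmc]] := cofinite_increasing_tail hJ.
have hE : h \o addn m = addn (m + c) by apply/funext => j /=; exact: hmc.
have ph : preserves h by exact: spr.
rewrite -{1}(fixed_tau_addn m tv) (Vop_comp _ ph (preserves_addn m)) hE.
  exact: fixed_tau_addn.
exact: preserves_addn.
Qed.

(** It suffices to test V_tau v - v against vec x with x in the copies of index
    less than m, for v = vec (alpha (addn m) y); there [gap m 1] fixes x and
    acts on the image of alpha (addn m) as the shift. *)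
Lemma tail_space_fixed_tau v : (forall m, tail_space m v) -> fixed_tau G v.
Proof.
move=> vP; apply/eqP; rewrite -subr_eq0; apply/eqP.
apply: (dense_inner_eq0 generated_vectors_dense) => _ [x [m xm] <-].
apply: (@lipschitz_eq0 R G R[i]^o _
  (fun v => inner (vec x) (Vop succn v - v)) (rnorm (vec x) * 2) _ _ _ (vP m)).
  move=> u w; rewrite -innerBr (le_trans (cauchy_schwarz _ _)) // -mulrA.
  by rewrite ler_wpM2l ?rnorm_ge0 // Vop_id_lipschitz //; exact: preserves_tau.
move=> _ [y _ <-]; rewrite Vop_vec; last exact: preserves_tau.
rewrite innerBr !inner_vec alpha_comp.
have [_ [_ gM] gS] := alpha_morphism P (gap m 1).
rewrite -[X in _ - X](spr (cofinite_gap m 1)) gM gS alpha_comp.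
have -> : gap m 1 \o addn m = succn \o addn m.
  by apply/funext => j; rewrite /gap /=; case: ifP; lia.
rewrite (@gen_alpha_eq _ _ _ `I_m (gap m 1) id x) ?alpha_id ?subrr //.
by move=> j /= jm; rewrite /gap jm.
Qed.

(** The operator S commutes with the copies of index at least k, hence with the
    algebra that they generate, and contractivity passes to its closure. *)
Lemma commutant_addn n k S x v :
  commutant [set T | exists k a, (n <= k)%N /\ T = gns_rep G (fp_in P k a)] S ->
  (n <= k)%N ->
  S (gns_rep G (alpha (addn k) x) v) = gns_rep G (alpha (addn k) x) (S v).
Proof.
move=> [/bounded_opP[SL [C C0 SC]] comS] nk.
have [aL [a1 aM] aS] := alpha_morphism P (addn k).
have gP := gns_repP G.
have gen y w : generated setT y ->
    S (gns_rep G (alpha (addn k) y) w) = gns_rep G (alpha (addn k) y) (S w).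
  move=> yg; elim: yg w => {y} [j a _||c y z _ yP _ zP|y z _ yP _ zP] w.
  - rewrite alphaE -[LHS]/((S \o gns_rep G (fp_in P (k + j) a)) w) comS //.
    by exists (k + j)%N, a; rewrite (leq_trans nk) // leq_addr.
  - by rewrite a1 !(rep1 gP).
  - by rewrite aL !(rep_lin gP) SL yP zP.
  - by rewrite aM !(repM gP) yP zP.
have contr y w : rnorm (gns_rep G (alpha (addn k) y) w) <= cnorm y * rnorm w.
  exact: rep_contractive (star_representation_comp gP (alpha_morphism P _)) y w.
apply/eqP; rewrite -subr_eq0; apply/eqP; apply: rnorm_small_eq0 => e e0.
pose M := C * rnorm v + rnorm (S v) + 1.
have M0 : 0 < M by rewrite ltr_wpDl // addr_ge0 ?mulr_ge0 ?rnorm_ge0.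
have [y yg] := gen_dense x (divr_gt0 e0 M0); rewrite ltr_pdivlMr // => xy.
have -> : S (gns_rep G (alpha (addn k) x) v)
      - gns_rep G (alpha (addn k) x) (S v)
    = S (gns_rep G (alpha (addn k) (x - y)) v)
      - gns_rep G (alpha (addn k) (x - y)) (S v).
  by rewrite (linB aL) !(repB gP) (linB SL) (gen y) // opprB addrA subrK.
apply: le_lt_trans (ler_rnormD _ _) _; rewrite rnormN.
have := SC (gns_rep G (alpha (addn k) (x - y)) v).
have := ler_wpM2l C0 (contr (x - y) v); have := contr (x - y) (S v).
rewrite /M in xy; have := cnorm_ge0 (x - y); lra.
Qed.

(** For y and z in the copies of index less than N, the map [gap N (k - N)]
    fixes y and z and sends alpha (addn N) x to alpha (addn k) x, so the inner
    products defining the weak limit are constant from N on. The limit is in the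
    tail algebra by [commutant_addn]: an S commuting with the copies of index at
    least n commutes with all the terms from n on. *)
Lemma tail_limit x : exists2 T, tail_algebra G T &
  wcvg (fun k => vec (alpha (addn k) x)) (T xi).
Proof.
have gP := gns_repP G.
have contr k w : rnorm (gns_rep G (alpha (addn k) x) w) <= cnorm x * rnorm w.
  exact: rep_contractive (star_representation_comp gP (alpha_morphism P _)) x w.
have /choice[T TP] u :
    exists l, wcvg (fun k => gns_rep G (alpha (addn k) x) u) l.
  apply: (wcvg_ex generated_vectors_dense (contr^~ u)) => _ e [z [m zm] <-] e0.
  (* Moving u to a generated vector costs at most cnorm x * rnorm (vec z) times
     the distance, uniformly in k. *)
  pose c := cnorm x * rnorm (vec z) + 1.
  have c0 : 0 < c by rewrite ltr_wpDl ?mulr_ge0 ?rnorm_ge0 ?cnorm_ge0.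
  have : closure generated_vectors u by rewrite generated_vectors_dense.
  move=> /closure_rnorm/(_ _ (divr_gt0 e0 c0))[_ [y [n yn] <-]].
  rewrite ltr_pdivlMr // => uy.
  pose N := maxn m n.
  exists N, (inner (vec z) (gns_rep G (alpha (addn N) x) (vec y))) => k Nk.
  have -> : inner (vec z) (gns_rep G (alpha (addn N) x) (vec y)) =
            inner (vec z) (gns_rep G (alpha (addn k) x) (vec y)).
    rewrite -!vecM !inner_vec -[LHS](spr (cofinite_gap N (k - N))).
    have [_ [_ gM] gS] := alpha_morphism P (gap N (k - N)).
    rewrite gM gS gM alpha_comp.
    have -> : gap N (k - N) \o addn N = addn k.
      by apply/funext => j; rewrite /gap /=; case: ifP; lia.
    have fix_gap l (w : P) : (l <= N)%N -> generated `I_l w ->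
        alpha (gap N (k - N)) w = w.
      move=> lN wl; rewrite (@gen_alpha_eq _ _ _ `I_l _ id w) ?alpha_id //.
      by move=> j /= jl; rewrite /gap (leq_trans jl lN).
    by rewrite (fix_gap n y) ?leq_maxr // (fix_gap m z) ?leq_maxl.
  rewrite -innerBr -(linB (rep_linear gP _)).
  apply: le_lt_trans (cauchy_schwarz _ _) _.
  have := ler_wpM2l (rnorm_ge0 (vec z)) (contr k (u - vec y)).
  rewrite /c in uy; have := rnorm_ge0 (u - vec y); lra.
exists T; last exact: TP.
have TB : bounded_op T.
  apply/bounded_opP; split.
    move=> c u v; apply: (wcvg_unique (TP _)).
    apply: (wcvg_eventually (n := 0) _ (wcvg_lin c (TP u) (TP v))) => k _.
    by rewrite (rep_linear gP).
  exists (cnorm x) => [|u]; first exact: cnorm_ge0.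
  rewrite -[T u]subr0; apply: (wcvg_le (TP u)) => k.
  by rewrite subr0.
move=> n _; split => // S SS; apply/funext => u /=.
apply: (wcvg_unique (TP (S u))).
apply: (wcvg_eventually (n := n) _ (wcvg_bounded_op SS.1 (TP u))) => k nk /=.
exact: commutant_addn SS nk.
Qed.

Lemma fixed_tau_closure_tail v : fixed_tau G v -> closure (tail_vectors G) v.
Proof.
move=> tv; apply/closure_rnorm => e e0; have e2 : 0 < e / 2 by rewrite divr_gt0.
have : closure (range (fun x => vec x)) v by rewrite gns_cyclic.
move=> /closure_rnorm/(_ _ e2)[_ [x _ <-] vx].
have [T Ttail Tx] := tail_limit x.
exists (T xi); first by exists T.
suff : rnorm (T xi - v) <= e / 2 by rewrite rnorm_distC; lra.
apply: (wcvg_le Tx) => k; have pk := preserves_addn k.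
rewrite -(Vop_vec _ pk) -{1}(fixed_tau_addn k tv) Vop_dist // rnorm_distC.
exact: ltW.
Qed.

Lemma tail_vectors_fixed h (ph : preserves h) :
  (forall v, (forall m, tail_space m v) -> Vop h v = v) ->
  closure (tail_vectors G) `<=` [set v | Vop h v = v].
Proof.
move=> hP v; apply: Vop_fixed_closure => // _ [T TP <-].
by apply: hP => m; exact: tail_algebra_space.
Qed.

Lemma fixed_tau_tail : fixed_tau G = closure (tail_vectors G).
Proof.
apply/seteqP; split => v; first exact: fixed_tau_closure_tail.
exact: (tail_vectors_fixed preserves_tau tail_space_fixed_tau).
Qed.

Section Exchangeable.
Hypothesis exch : exchangeable phi.

Lemma tail_space_fixed_perm s v : finitary_perm s ->
  (forall m, tail_space m v) -> Vop s v = v.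
Proof.
move=> sP vP; have [m sm] := finitary_shift sP.
have ps : preserves s by exact: exch.
apply: (Vop_fixed_closure ps _ (vP m)) => _ [x _ <-].
rewrite Vop_vec // alpha_comp.
by have -> : s \o addn m = addn m by apply/funext => j /=; exact: sm.
Qed.

(** A vector fixed by all permutations is approximated by some vec x with x in
    finitely many copies, on which [rotation m] and the shift agree. *)
Lemma fixed_tau_P : fixed_tau G = fixed_P G.
Proof.
apply/seteqP; split => v; first rewrite fixed_tau_tail => vt s sP.
  apply: (tail_vectors_fixed _ _ vt); first by exact: exch.
  by move=> w; exact: tail_space_fixed_perm.
move=> vP; apply/eqP; rewrite -subr_eq0; apply/eqP.
apply: rnorm_small_eq0 => e e0.
have e2 : 0 < e / 2 by rewrite divr_gt0.
have : closure generated_vectors v by rewrite generated_vectors_dense.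
move=> /closure_rnorm/(_ _ e2)[_ [x [m xm] <-] vx].
have sP := finitary_rotation m; have ps : preserves (rotation m) by exact: exch.
have pt := preserves_tau.
have E : Vop succn (vec x) = Vop (rotation m) (vec x).
  rewrite !Vop_vec //; congr (gns_rep G _ xi).
  by apply: gen_alpha_eq xm => j /= jm; rewrite /rotation jm.
have := Vop_dist (vec x) v ps; rewrite (vP _ sP) -E => h1.
have := Vop_dist v (vec x) pt.
have := ler_rnorm_distD (Vop succn (vec x)) (Vop succn v) v.
rewrite h1 (rnorm_distC (vec x)); lra.
Qed.

End Exchangeable.

End Spreadable.

End Operators.

Theorem theorem3p3 (R : realType) (A : cstarAlgType R) (P : free_product A)
    (phi : {scalar P}) (G : gns_triple phi) :
  is_state phi -> spreadable phi ->
  (fixed_tau G = fixed_J G /\ fixed_J G = closure (tail_vectors G)) /\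
  (exchangeable phi ->
     fixed_tau G = fixed_J G /\ fixed_J G = fixed_P G /\
     fixed_P G = closure (tail_vectors G)).
Proof.
move=> _ spr; have EJ := fixed_tau_J G spr; have ET := fixed_tau_tail G spr.
split=> [|exch]; first by rewrite -EJ.
by rewrite -EJ -(fixed_tau_P G spr exch).
Qed.
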